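(* Let $q,\rho_{12},\rho_{13},\rho_{23}\in(-1,1)$, $r=\rho_{12}\rho_{13}\rho_{23}$, and let $(X,Y,Z)$ have the joint density $f_{3D}(x,y,z|\rho_{12},\rho_{13},\rho_{23},q)$ defined in the context. Then for all $n,m\ge0$, $E(H_n(X|q)H_m(Y|q)|Z)$ is a polynomial of order at most $n+m$ in the conditioning random variable $Z$. In particular $$E(XY|Z=z)=z^2\,\frac{\rho_{12}(\rho_{13}^2+\rho_{23}^2)(1-qr)+(1-r)(\rho_{13}\rho_{23}+qr\rho_{12})}{(1+r)(1-qr^2)}+\frac{\rho_{12}(1-\rho_{13}^2)(1-\rho_{23}^2)}{1-qr^2}.$$
   Context: For $|q|<1$ let $S(q)=[-2/\sqrt{1-q},2/\sqrt{1-q}]$, $[0]_q=0$, $[n]_q=1+q+\dots+q^{n-1}$ for $n\ge1$, and $(a)_\infty=\prod_{k=0}^\infty(1-aq^k)$. Define $$l_q(x|a)=(1+a)^2-(1-q)ax^2,\qquad \omega_q(x,y|\rho)=(1-\rho^2)^2-(1-q)xy\rho(1+\rho^2)+(1-q)\rho^2(x^2+y^2),$$ $$f_N(x|q)=\frac{(q)_\infty\sqrt{1-q}\sqrt{4-(1-q)x^2}}{2\pi}\prod_{i=1}^\infty l_q(x|q^i),\quad x\in S(q).$$ The three-dimensional density is, for $x,y,z\in S(q)$, $$f_{3D}(x,y,z|\rho_{12},\rho_{13},\rho_{23},q)=f_N(x|q)f_N(y|q)f_N(z|q)\frac{C_{3D}(\rho_{12}^2)_\infty(\rho_{13}^2)_\infty(\rho_{23}^2)_\infty}{\prod_{i=0}^\infty\left(\omega_q(x,y|\rho_{12}q^i)\,\omega_q(x,z|\rho_{13}q^i)\,\omega_q(y,z|\rho_{23}q^i)\right)},$$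 with $C_{3D}$ the constant making it a probability density on $S(q)^3$. The $q$-Hermite polynomials are given by $H_{-1}(x|q)=0$, $H_0(x|q)=1$, $H_{n+1}(x|q)=xH_n(x|q)-[n]_qH_{n-1}(x|q)$. Equalities involving conditional expectations hold almost surely with respect to the distribution of the conditioning random variable. *)

(* Defs.v *)
From HB Require Import structures.
From mathcomp Require Import all_boot all_order all_algebra.
From mathcomp Require Import all_classical all_reals all_analysis measurable_realfun.
Set Implicit Arguments.
Unset Strict Implicit.
Unset Printing Implicit Defensive.
Import Order.TTheory GRing.Theory Num.Theory.
Import numFieldNormedType.Exports.
Local Open Scope classical_set_scope.
Local Open Scope ring_scope.

Definition infprod (R : realType) (u : nat -> R) : R :=
  limn (fun n => \prod_(k < n) u k).

Definition qnum (R : realType) (q : R) (n : nat) : R := \sum_(k < n) q ^+ k.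

(* (a)_oo = prod_(k >= 0) (1 - a q^k) *)
Definition qpoch (R : realType) (q a : R) : R :=
  infprod (fun k => 1 - a * q ^+ k).

(* H_0 = 1 and H_(k+1) = x H_k - [k]_q H_(k-1), where H_(-1) = 0. *)
Fixpoint qHermite (R : realType) (q : R) (n : nat) {struct n} : {poly R} :=
  if n is k.+1 then
    'X * qHermite q k
      - qnum q k *: (if k is j.+1 then qHermite q j else 0)
  else 1.

Definition Sq (R : realType) (q : R) : set R :=
  `[- (2 / Num.sqrt (1 - q)), 2 / Num.sqrt (1 - q)].

Definition lq (R : realType) (q x a : R) : R :=
  (1 + a) ^+ 2 - (1 - q) * a * x ^+ 2.

Definition omegaq (R : realType) (q x y rho : R) : R :=
  (1 - rho ^+ 2) ^+ 2 - (1 - q) * x * y * rho * (1 + rho ^+ 2)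
    + (1 - q) * rho ^+ 2 * (x ^+ 2 + y ^+ 2).

Definition fN (R : realType) (q x : R) : R :=
  qpoch q q * Num.sqrt (1 - q) * Num.sqrt (4 - (1 - q) * x ^+ 2) / (2 * pi)
    * infprod (fun i => lq q x (q ^+ i.+1)).

(* [measurableTypeR R] is R with its Borel sets, the carrier of
   [lebesgue_measure]. *)
Definition leb3 (R : realType) :
    set (measurableTypeR R * measurableTypeR R * measurableTypeR R)%type
    -> \bar R :=
  ((@lebesgue_measure R \x @lebesgue_measure R) \x @lebesgue_measure R)%E.

Definition Sq3 (R : realType) (q : R) : set (R * R * R) :=
  (Sq q `*` Sq q) `*` Sq q.

Definition f3D_unnorm (R : realType) (r12 r13 r23 q x y z : R) : R :=
  fN q x * fN q y * fN q z
    * (qpoch q (r12 ^+ 2) * qpoch q (r13 ^+ 2) * qpoch q (r23 ^+ 2)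
       / infprod (fun i => omegaq q x y (r12 * q ^+ i)
                           * omegaq q x z (r13 * q ^+ i)
                           * omegaq q y z (r23 * q ^+ i))).

(* The constant normalizing [f3D] to total mass 1 on [Sq3 q]. *)
Definition C3D (R : realType) (r12 r13 r23 q : R) : R :=
  (fine (\int[@leb3 R]_(u in Sq3 q)
     (f3D_unnorm r12 r13 r23 q u.1.1 u.1.2 u.2)%:E))^-1.

Definition f3D (R : realType) (r12 r13 r23 q x y z : R) : R :=
  C3D r12 r13 r23 q * f3D_unnorm r12 r13 r23 q x y z.

(* (X, Y, Z) has density f on D (and density 0 off D) w.r.t. Lebesgue measure *)
Definition has_joint_density d (T : measurableType d) (R : realType)
    (P : probability T R) (X Y Z : {RV P >-> R})
    (D : set (R * R * R)) (f : R -> R -> R -> R) : Prop :=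
  forall A : set (R * R * R), measurable A ->
    P [set w | A (X w, Y w, Z w)]
      = (\int[@leb3 R]_(u in A `&` D) (f u.1.1 u.1.2 u.2)%:E)%E.

Definition sigma_of d (T : measurableType d) (R : realType)
    (P : probability T R) (Z : {RV P >-> R}) : set (set T) :=
  preimage_set_system [set: T] Z measurable.

(* V is a version of E(U | Z) *)
Definition is_condexp d (T : measurableType d) (R : realType)
    (P : probability T R) (U : T -> R) (Z : {RV P >-> R}) (V : T -> R) : Prop :=
  [/\ P.-integrable [set: T] (EFin \o U),
      P.-integrable [set: T] (EFin \o V),
      forall B : set R, measurable B -> sigma_of Z (V @^-1` B)
    & forall A : set T, sigma_of Z A ->
        (\int[P]_(w in A) (V w)%:E = \int[P]_(w in A) (U w)%:E)%E].

(* g is a version of z |-> E(U | Z = z).  Versions agree almost surely w.r.t.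
   the distribution of Z, so "E(U | Z = z) = g z for almost every z" is
   expressed as [is_regression U Z g]. *)
Definition is_regression d (T : measurableType d) (R : realType)
    (P : probability T R) (U : T -> R) (Z : {RV P >-> R}) (g : R -> R) : Prop :=
  measurable_fun [set: R] g /\ is_condexp U Z (g \o Z).

(* Main.v *)
Require Import Defs.
From HB Require Import structures.
From mathcomp Require Import all_boot all_order all_algebra.
From mathcomp Require Import all_classical all_reals all_analysis measurable_realfun.
From mathcomp Require Import ring lra zify.
Set Implicit Arguments.
Unset Strict Implicit.
Unset Printing Implicit Defensive.
Import Order.TTheory GRing.Theory Num.Theory.
Import numFieldNormedType.Exports.
Local Open Scope classical_set_scope.
Local Open Scope ring_scope.

(** Why E(H_n(X) H_m(Y) | Z) is a polynomial in Z.

    Put u = sqrt(1-q) x, so that S(q) becomes [-2, 2], and let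
    h_n(u) = (1-q)^(n/2) H_n(x); then h_(n+1) = u h_n - (1 - q^n) h_(n-1).
    Write (q)_n for the product of the 1 - q^k with 1 <= k <= n.  The proof
    is driven by the Carlitz kernels

      C_ij(u, v | rho) = sum_n rho^n / (q)_n h_(n+i)(u) h_(n+j)(v),

    C_00 being the Poisson-Mehler kernel.  Inserting the recurrence of h in
    this series expresses u C_ij and v C_ij through neighbouring kernels
    ([carlitz_mulu], [carlitz_mulv]), with constant coefficients.  These two
    relations have the following consequences.

    - They give (1 - rho^2)(1 - q rho^2) C_00(q rho) = omega C_00(rho)
      ([mehler_qshift]).  Iterating, with C_00(q^N rho) tending to 1, yields the
      Poisson-Mehler formula ([mehler_product]).  So f3D is, up to a constant,
      fN(x) fN(y) fN(z) times three Poisson-Mehler kernels ([f3D_mehler]).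

    - On the diagonal u = v = z they form a linear system whose determinant
      1 - q^(i+j) rho^2 does not vanish, so C_ij(z, z) is C_00(z, z) times a
      polynomial of degree at most i + j ([diag_poly_carlitz]).

    - Multiplication by h_n(u) maps the span of the C_ij with i + j <= k into
      the span of those with i + j <= k + n ([carlitz_span_qherm]).

    The h_n are orthogonal for the weight fN, with norms c (q)_n for a constant
    c ([qherm_orthogonal]); integrating the series termwise therefore composes
    kernels: the integral over x of C_ij(u, v | a) C_00(u, w | b) fN(x) is
    c b^i C_ji(v, w | a b) ([integral_carlitz]).  Integrating
    h_n h_m f3D over x and then over y thus leaves a combination of the
    C_ij(z, z | r) with i + j <= n + m, that is a polynomial of degree at most
    n + m times the result for n = m = 0 ([cond_integral_poly]).  The latter is
    the density of Z up to fN(z), powers of c and the constant C3D; these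
    factors are common to both integrals, so they cancel and their values are
    never needed.  For n = m = 1 the only kernels left are C_11, C_02 and C_00,
    and solving the linear system for them gives the explicit formula
    ([cond_integral_11]).

    Orthogonality is obtained without trigonometric substitution.  Chebyshev
    polynomials of positive degree integrate to 0 against the semicircle
    density because of an explicit antiderivative ([cheb_integral]).  Each
    factor l_q(x | q^i) of fN acts on them by a three-term rule, so the moments
    of the product truncated at N satisfy a recurrence in N, solved by the
    coefficients of the finite Jacobi triple product ([trunc_moment_even]).
    Letting N tend to infinity gives the Chebyshev moments of fN, from which
    the recurrence of h computes the integrals of h_n times Chebyshev, and then
    of h_n h_m.

    The passage to conditional expectations tests the candidate regression
    on the events Z in B: the integral over such an event is an integral
    against the density ([integral_triple]), and Fubini reduces it to the
    identity above for each z ([condexp_of_cond_integral]). *)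

(** * Geometric convergence *)

Section GeometricControl.
Context {R : realType}.

(** The source of all geometric bounds below: series are dominated by writing
    their terms as products of factors with a limit less than 1, which avoids
    separate treatment of polynomial and infinite-product factors. *)
Lemma prod_le_geometric (a : nat -> R) (l : R) :
  (forall k, 0 <= a k) -> a @ \oo --> l -> l < 1 ->
  exists K s : R, [/\ 0 <= K, 0 < s, s < 1 &
    forall n, \prod_(k < n) a k <= K * s ^+ n].
Proof.
move=> a0 al l1.
have l0 : 0 <= l.
  by rewrite -(cvg_lim _ al)//; apply: limr_ge; [apply/cvg_ex; exists l|exact: nearW].
pose s := (1 + l) / 2.
have s0 : 0 < s by rewrite /s; lra.
have s1 : s < 1 by rewrite /s; lra.
have [N _ aN] : \forall k \near \oo, a k <= s.
  by apply: (cvgr_le l) => //; rewrite /s; lra.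
pose c n := (\prod_(k < n) a k) / s ^+ n.
have c0 n : 0 <= c n.
  by apply: divr_ge0; [apply: prodr_ge0|exact/exprn_ge0/ltW].
have cS n : (N <= n)%N -> c n.+1 <= c n.
  move=> Nn; have -> : c n.+1 = c n * (a n / s).
    by rewrite /c big_ord_recr/= exprSr invfM; ring.
  by rewrite ler_piMr// ler_pdivrMr// mul1r; apply: aN.
(* The ratios c n decrease from N on; the sum bounds the finitely many
   earlier ones together with c N. *)
exists (\sum_(n < N.+1) c n), s; split=> //.
  exact: sumr_ge0.
move=> n; rewrite -ler_pdivrMr ?exprn_gt0// -/(c n).
have le_small m : (m <= N)%N -> c m <= \sum_(n < N.+1) c n.
  move=> mN; rewrite (bigD1 (Ordinal (mN : (m < N.+1)%N)))//= lerDl.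
  exact: sumr_ge0.
have [/le_small//|/ltnW] := leqP n N.
move=> /subnK <-; elim: (n - N)%N => [|m IH]; first by rewrite add0n le_small.
by apply: le_trans IH; rewrite addSn; apply: cS; rewrite leq_addl.
Qed.

(** The error bound is explicit so that a bound on the increments which is
    uniform in a parameter gives convergence uniform in that parameter. *)
Lemma geometric_increments (p : nat -> R) (K s : R) :
  0 <= K -> 0 <= s -> s < 1 -> (forall n, `|p n.+1 - p n| <= K * s ^+ n) ->
  p @ \oo --> limn p /\
  forall n, `|limn p - p n| <= K / (1 - s) * s ^+ n.
Proof.
move=> K0 s0 s1 pK.
have s1' : 0 < 1 - s by lra.
have tail n m : `|p (n + m)%N - p n| <= K / (1 - s) * s ^+ n.
  suff : `|p (n + m)%N - p n| <= K / (1 - s) * (s ^+ n - s ^+ (n + m)).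
    move=> /le_trans; apply; apply: ler_wpM2l; first by apply: divr_ge0 => //; lra.
    by rewrite gerBl exprn_ge0.
  elim: m => [|m IH]; first by rewrite addn0 !subrr normr0 mulr0.
  rewrite addnS.
  have -> : p (n + m).+1 - p n = (p (n + m).+1 - p (n + m)%N) + (p (n + m)%N - p n).
    by ring.
  apply: le_trans (ler_normD _ _) _; apply: le_trans (lerD (pK _) IH) _.
  rewrite [s ^+ (n + m).+1]exprS; set t := s ^+ (n + m); set r := s ^+ n.
  by rewrite [leLHS](_ : _ = K / (1 - s) * (r - s * t))//; field; rewrite gt_eqF.
have cp : cvgn p.
  have -> : p = (fun n => p 0%N + series (fun n => p n.+1 - p n) n).
    apply/funext => n; rewrite /series/= telescope_sumr// addrCA subrr addr0//.
  apply: is_cvgD; first exact: is_cvg_cst.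
  apply: normed_cvg; apply: (@series_le_cvg _ _ (geometric K s)) => //.
  - by move=> n /=; exact: normr_ge0.
  - by move=> n; apply: mulr_ge0 => //; apply: exprn_ge0.
  - by apply: is_cvg_geometric_series; rewrite ger0_norm.
split=> // n.
have dn : (fun m => `|p m - p n|) @ \oo --> `|limn p - p n|.
  by apply: cvg_norm; apply: cvgB => //; exact: cvg_cst.
rewrite -(cvg_lim _ dn)//; apply: limr_le; first by apply/cvg_ex; eexists; exact: dn.
exists n => // m /= nm; rewrite -(subnKC nm); exact: tail.
Qed.

Lemma squeeze0 (f g : nat -> R) :
  (forall n, `|f n| <= g n) -> g @ \oo --> (0:R) -> f @ \oo --> (0:R).
Proof.
move=> fg g0; apply/norm_cvg0P; apply: (squeeze_cvgr _ (cvg_cst 0) g0).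
by apply: nearW => n; rewrite fg normr_ge0.
Qed.

Lemma squeeze_dist (f g : nat -> R) (l : R) :
  (forall n, `|f n - l| <= g n) -> g @ \oo --> (0:R) -> f @ \oo --> l.
Proof.
move=> fg g0; apply/subr_cvg0; exact: squeeze0 g0.
Qed.

Lemma cvg_geometric0 (K s : R) : `|s| < 1 -> (fun n => K * s ^+ n) @ \oo --> (0:R).
Proof. by move=> s1; exact: cvg_geometric. Qed.

Lemma limn_eq (f g : nat -> R) (a b : R) :
  f =1 g -> f @ \oo --> a -> g @ \oo --> b -> a = b.
Proof. by move=> /funext -> fa gb; rewrite -(cvg_lim _ fa)// -(cvg_lim _ gb). Qed.

Lemma limn_ge0 (f : nat -> R) (a : R) : (forall n, 0 <= f n) -> f @ \oo --> a -> 0 <= a.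
Proof.
move=> f0 fa; rewrite -(cvg_lim _ fa)//; apply: limr_ge; first by apply/cvg_ex; exists a.
exact: nearW.
Qed.

Lemma limn_norm_le (f : nat -> R) (a b : R) :
  (forall n, `|f n| <= b) -> f @ \oo --> a -> `|a| <= b.
Proof.
move=> fb fa; have cn : (fun n => `|f n|) @ \oo --> `|a| by exact: cvg_norm.
rewrite -(cvg_lim _ cn)//; apply: limr_le; first by apply/cvg_ex; eexists; exact: cn.
exact: nearW.
Qed.
End GeometricControl.

(** * Rescaled q-Hermite polynomials and their growth *)

Section Hermite.
Context {R : realType}.
Implicit Types (q u v rho : R).

(** The polynomials h_n of the rescaled variable u = sqrt(1-q) x, by the
    recurrence that defines the q-Hermite polynomials; see [qHermite_qherm]. *)
Fixpoint qherm q u (n : nat) : R :=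
  if n is k.+1 then
    u * qherm q u k - (1 - q ^+ k) * (if k is j.+1 then qherm q u j else 0)
  else 1.

Lemma qherm0 q u : qherm q u 0 = 1. Proof. by []. Qed.

(** Valid at n = 0 too, where the coefficient 1 - q^0 cancels the last term. *)
Lemma qhermS q u n : qherm q u n.+1 = u * qherm q u n - (1 - q ^+ n) * qherm q u n.-1.
Proof. by case: n => [|n] //=; rewrite expr0 subrr !mul0r. Qed.

Lemma qherm1 q u : qherm q u 1 = u.
Proof. by rewrite qhermS expr0 subrr mul0r subr0 mulr1. Qed.

Arguments qherm : simpl never.

(** At q = 0 the h_n are the Chebyshev polynomials of the second kind in u / 2. *)
Definition cheb u n : R := qherm 0 u n.

Lemma cheb0 u : cheb u 0 = 1. Proof. by []. Qed.

Lemma cheb1 u : cheb u 1 = u. Proof. exact: qherm1. Qed.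

Lemma chebSS u n : cheb u n.+2 = u * cheb u n.+1 - cheb u n.
Proof. by rewrite /cheb qhermS expr0n/= subr0 mul1r. Qed.

(** The quadratic form conserved by the recurrence.  On [-2, 2] it forces
    consecutive absolute values to differ by at most 1. *)
Lemma cheb_invariant u n :
  cheb u n.+1 ^+ 2 - u * cheb u n.+1 * cheb u n + cheb u n ^+ 2 = 1.
Proof.
elim: n => [|n IH]; first by rewrite /cheb qherm1 qherm0; ring.
by rewrite chebSS -[RHS]IH; ring.
Qed.

Lemma cheb_bound u n : `|u| <= 2 -> `|cheb u n| <= n.+1%:R.
Proof.
move=> u2; elim: n => [|n IH]; first by rewrite /cheb qherm0 normr1.
have := cheb_invariant u n; set a := cheb u n.+1; set b := cheb u n => inv.
have uab : u * a * b <= 2 * (`|a| * `|b|).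
  apply: le_trans (ler_norm _) _; rewrite !normrM -mulrA.
  by apply: ler_wpM2r => //; rewrite mulr_ge0.
(* The invariant dominates this square since |u| <= 2. *)
have step : (`|a| - `|b|) ^+ 2 <= 1.
  by rewrite sqrrB !real_normK ?num_real//; lra.
have : `|a| - `|b| <= 1 by nra.
rewrite lerBlDr => /le_trans; apply; rewrite -[n.+2%:R]natr1 addrC lerD2r.
exact: IH.
Qed.

(** Variation of constants: h solves the Chebyshev recurrence with the source
    term q^(k+1) h_k, which is summable because of the geometric factor. *)
Lemma qherm_variation q u n :
  qherm q u n = cheb u n
    + \sum_(k < n.-1) cheb u (n.-2 - k) * (q ^+ k.+1 * qherm q u k).
Proof.
suff : forall n, qherm q u n = cheb u n
    + \sum_(k < n.-1) cheb u (n.-2 - k) * (q ^+ k.+1 * qherm q u k) /\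
    qherm q u n.+1 = cheb u n.+1
    + \sum_(k < n) cheb u (n.-1 - k) * (q ^+ k.+1 * qherm q u k).
  by move=> /(_ n)[].
elim=> [|m [IH1 IH2]]; first by rewrite !big_ord0 !addr0 /cheb !qherm1 !qherm0.
split=> //=; rewrite qhermS /= mulrBl mul1r {1}IH2 {1}IH1 chebSS.
rewrite big_ord_recr/= subnn cheb0 mul1r.
suff -> : \sum_(k < m) cheb u (m - k) * (q ^+ k.+1 * qherm q u k) =
    u * (\sum_(k < m) cheb u (m.-1 - k) * (q ^+ k.+1 * qherm q u k))
    - \sum_(k < m.-1) cheb u (m.-2 - k) * (q ^+ k.+1 * qherm q u k) by ring.
case: m {IH1 IH2} => [|m]; first by rewrite !big_ord0 mulr0 subrr.
rewrite /= !big_ord_recr/= subSnn subnn mulrDr.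
rewrite cheb1 cheb0 mul1r addrAC; congr +%R.
rewrite mulr_sumr -sumrB; apply: eq_bigr => k _.
have km : (k < m)%N by [].
have -> : (m.+1 - k = (m.-1 - k).+2)%N by lia.
have -> : (m - k = (m.-1 - k).+1)%N by lia.
by rewrite chebSS; ring.
Qed.

(** The product of the first n factors is (n + 1) prod_k (1 + (k+1) |q|^(k+1)),
    a linear growth times a convergent product.  The factors tend to 1, which is
    what keeps the kernels convergent for every |rho| < 1. *)
Definition growth q (k : nat) : R :=
  (1 + k.+1%:R^-1) * (1 + k.+1%:R * `|q| ^+ k.+1).

Lemma growth_ge1 q k : 1 <= growth q k.
Proof.
rewrite -[X in X <= _]mulr1; apply: ler_pM => //; rewrite lerDl.
  by rewrite invr_ge0.
by rewrite mulr_ge0// exprn_ge0.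
Qed.

Lemma prod_harmonic n : \prod_(k < n) (1 + k.+1%:R^-1 : R) = n.+1%:R.
Proof.
elim: n => [|n IH]; first by rewrite big_ord0.
by rewrite big_ord_recr/= IH mulrDr mulr1 divff ?pnatr_eq0// natr1.
Qed.

(** A discrete Gronwall argument: with a_k = (k+1) |q|^(k+1) and P_n the product
    of the 1 + a_k over k < n, the bound inserted in [qherm_variation]
    telescopes because a_k P_k = P_(k+1) - P_k. *)
Lemma qherm_bound q u n : `|u| <= 2 -> `|qherm q u n| <= \prod_(k < n) growth q k.
Proof.
move=> u2; rewrite /growth big_split/= prod_harmonic.
set a := fun k : nat => k.+1%:R * `|q| ^+ k.+1.
have a0 k : 0 <= a k by rewrite mulr_ge0// exprn_ge0.
pose P n := \prod_(k < n) (1 + a k); rewrite -/(P n).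
have P1 m : 1 <= P m.
  elim: m => [|m IH]; rewrite /P; first by rewrite big_ord0.
  rewrite big_ord_recr/= -[X in X <= _]mulr1; apply: ler_pM => //.
  by rewrite lerDl.
have PS m : P m.+1 = P m + a m * P m by rewrite /P big_ord_recr/=; ring.
have sumP m : \sum_(k < m) a k * P k = P m - 1.
  elim: m => [|m IH]; first by rewrite big_ord0 /P big_ord0 subrr.
  by rewrite big_ord_recr/= IH PS; ring.
have [m] := ubnP n; elim: m n => // m IH n nm.
rewrite qherm_variation; apply: le_trans (ler_normD _ _) _.
have -> : n.+1%:R * P n = n.+1%:R + n.+1%:R * (P n - 1) by ring.
apply: lerD; first exact: cheb_bound.
apply: le_trans (ler_norm_sum _ _ _) _.
have -> : P n - 1 = \sum_(k < n) a k * P k by rewrite sumP.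
apply: (@le_trans _ _ (\sum_(k < n.-1) n.+1%:R * (a k * P k))); last first.
  rewrite -mulr_sumr; apply: ler_wpM2l => //.
  case: n {nm} => [|n] /=; first by rewrite !big_ord0.
  by rewrite [leRHS]big_ord_recr/= lerDl mulr_ge0// (le_trans ler01).
apply: ler_sum => k _; rewrite !normrM.
have kn := ltn_ord k.
apply: ler_pM => //.
  by apply: le_trans (cheb_bound _ u2) _; rewrite ler_nat; lia.
rewrite normrX /a [X in _ <= X * _]mulrC -mulrA; apply: ler_wpM2l.
  by rewrite exprn_ge0.
by apply: IH; lia.
Qed.

(** n |q|^n tends to 0: the factors |q| (1 + 1/(k+1)) of this product tend to
    |q| < 1. *)
Lemma cvg_nat_geometric q : `|q| < 1 ->
  (fun n => n.+1%:R * `|q| ^+ n.+1) @ \oo --> (0 : R).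
Proof.
move=> q1; pose a k : R := `|q| * (1 + k.+1%:R^-1).
have a0 k : 0 <= a k by rewrite mulr_ge0// addr_ge0// invr_ge0.
have al : a @ \oo --> `|q|.
  rewrite [X in _ --> X](_ : _ = `|q| * (1 + 0)); last by rewrite addr0 mulr1.
  apply: cvgM; first exact: cvg_cst.
  apply: cvgD; first exact: cvg_cst.
  exact: cvg_harmonic.
have [K [s [K0 s0 s1 aK]]] := prod_le_geometric a0 al q1.
apply: (squeeze0 _ (cvg_geometric0 (`|q| * K) (_ : `|s| < 1))); last first.
  by rewrite gtr0_norm.
move=> n; rewrite ger0_norm ?mulr_ge0 ?exprn_ge0// exprS mulrCA -mulrA.
apply: ler_wpM2l => //; apply: le_trans (aK n).
by rewrite /a big_split/= prod_harmonic prodr_const card_ord mulrC.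
Qed.

Lemma cvg_growth q : `|q| < 1 -> growth q @ \oo --> (1 : R).
Proof.
move=> q1.
rewrite [X in _ --> X](_ : _ = (1 + 0) * (1 + 0)); last by rewrite addr0 mulr1.
apply: cvgM; apply: cvgD; [exact: cvg_cst|exact: cvg_harmonic|exact: cvg_cst|].
exact: cvg_nat_geometric.
Qed.

(** The q-Pochhammer symbol (q; q)_n, equal to (1-q)^n [n]_q!. *)
Definition qfact q n : R := \prod_(k < n) (1 - q ^+ k.+1).

Lemma qfactS q n : qfact q n.+1 = qfact q n * (1 - q ^+ n.+1).
Proof. by rewrite /qfact big_ord_recr. Qed.

Lemma onesubX_gt0 q n : `|q| < 1 -> 0 < 1 - q ^+ n.+1.
Proof.
move=> q1; rewrite subr_gt0; apply: le_lt_trans (ler_norm _) _.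
by rewrite normrX exprn_ilt1.
Qed.

Lemma qfact_gt0 q n : `|q| < 1 -> 0 < qfact q n.
Proof. by move=> q1; apply: prodr_gt0 => k _; exact: onesubX_gt0. Qed.

Definition carlitz_term q rho i j u v (n : nat) : R :=
  rho ^+ n / qfact q n * (qherm q u (n + i) * qherm q v (n + j)).

(** Term n is at most a constant times the product over k < n of factors that
    tend to |rho|, so it decays geometrically, uniformly on the square. *)
Lemma carlitz_term_bound q rho i j : `|q| < 1 -> `|rho| < 1 ->
  exists K s : R, [/\ 0 <= K, 0 < s, s < 1 &
    forall u v n, `|u| <= 2 -> `|v| <= 2 ->
      `|carlitz_term q rho i j u v n| <= K * s ^+ n].
Proof.
move=> q1 r1.
have g0 k : 0 <= growth q k by apply: le_trans (growth_ge1 _ _).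
pose a k := `|rho| * ((1 - `|q| ^+ k.+1)^-1 * (growth q (k + i) * growth q (k + j))).
have qq1 : `| `|q| | < 1 by rewrite normr_id.
have a0 k : 0 <= a k.
  by rewrite /a !mulr_ge0// invr_ge0 ltW// onesubX_gt0.
have al : a @ \oo --> `|rho|.
  rewrite -[X in _ --> X]mulr1; apply: cvgM; first exact: cvg_cst.
  rewrite -[X in _ --> X]mulr1; apply: cvgM.
    rewrite -[X in _ --> X]invr1; apply: cvgV; first exact: oner_neq0.
    rewrite -[X in _ --> X]subr0; apply: cvgB; first exact: cvg_cst.
    have := cvg_geometric0 `|q| qq1.
    by under eq_fun do rewrite -exprS.
  rewrite -[X in _ --> X]mulr1; apply: cvgM.
    by move: (cvg_growth q1); rewrite -(cvg_shiftn i).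
  by move: (cvg_growth q1); rewrite -(cvg_shiftn j).
have [K [s [K0 s0 s1 aK]]] := prod_le_geometric a0 al r1.
pose C i := \prod_(k < i) growth q k.
have C0 l : 0 <= C l by apply: prodr_ge0.
exists (C i * C j * K), s; split=> //; first by rewrite !mulr_ge0.
move=> u v n u2 v2; apply: (@le_trans _ _ (C i * C j * \prod_(k < n) a k)); last first.
  by rewrite -[leRHS]mulrA; apply: ler_wpM2l; [exact: mulr_ge0|exact: aK].
have split_growth l : \prod_(k < n + l) growth q k = C l * \prod_(k < n) growth q (k + l).
  rewrite addnC big_split_ord/=; congr *%R; apply: eq_bigr => k _.
  by rewrite addnC.
rewrite /a; do 3 rewrite big_split/=.
rewrite prodr_const card_ord prodfV.
rewrite /carlitz_term !normrM normfV normrX.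
have qfle : \prod_(k < n) (1 - `|q| ^+ k.+1) <= `|qfact q n|.
  rewrite /qfact normr_prod; apply: ler_prod => k _.
  rewrite ltW ?onesubX_gt0//=; apply: le_trans (lerB_dist _ _).
  by rewrite normr1 normrX.
have h1 := qherm_bound q (n + i) u2; have h2 := qherm_bound q (n + j) v2.
move: h1 h2; rewrite !split_growth => h1 h2.
set A := \prod_(k < n) growth q (k + i); set B := \prod_(k < n) growth q (k + j).
set D := (\prod_(k < n) (1 - `|q| ^+ k.+1))^-1.
have -> : C i * C j * (`|rho| ^+ n * (D * (A * B))) =
          `|rho| ^+ n * D * ((C i * A) * (C j * B)) by ring.
apply: ler_pM; rewrite ?mulr_ge0 ?invr_ge0 ?exprn_ge0//.
  apply: ler_wpM2l; first by rewrite exprn_ge0.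
  by rewrite lef_pV2// posrE ?normr_gt0 ?gt_eqF ?qfact_gt0// prodr_gt0// => k _; rewrite onesubX_gt0.
by apply: ler_pM.
Qed.
End Hermite.
#[global] Arguments qherm : simpl never.

(** * Infinite products *)

Section InfiniteProducts.
Context {R : realType}.
Implicit Types (q a C : R).

(** K and s do not depend on v: for factors depending on a parameter the
    convergence of the infinite product is uniform. *)
Lemma partial_prod_increments q C : `|q| < 1 -> 0 <= C ->
  exists K s : R, [/\ 0 <= K, 0 < s, s < 1 &
    forall v : nat -> R, (forall k, `|v k - 1| <= C * `|q| ^+ k) ->
    forall n, `|\prod_(k < n.+1) v k - \prod_(k < n) v k| <= K * s ^+ n].
Proof.
move=> q1 C0; pose a k : R := `|q| * (1 + C * `|q| ^+ k).
have b0 k : 0 <= C * `|q| ^+ k by rewrite mulr_ge0// exprn_ge0.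
have a0 k : 0 <= a k by rewrite mulr_ge0// addr_ge0.
have al : a @ \oo --> `|q|.
  rewrite [X in _ --> X](_ : _ = `|q| * (1 + 0)); last by rewrite addr0 mulr1.
  apply: cvgM; first exact: cvg_cst.
  apply: cvgD; first exact: cvg_cst.
  by apply: cvg_geometric0; rewrite normr_id.
have [K [s [K0 s0 s1 aK]]] := prod_le_geometric a0 al q1.
exists (C * K), s; split=> //; first exact: mulr_ge0.
move=> v vC n; rewrite big_ord_recr/= -{2}[\prod_(k < n) v k]mulr1 -mulrBr normrM.
apply: (@le_trans _ _ (C * \prod_(k < n) a k)); last first.
  by rewrite -mulrA; apply: ler_wpM2l.
rewrite /a big_split/= prodr_const card_ord mulrA mulrC.
apply: ler_pM => //; rewrite normr_prod; apply: ler_prod => k _.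
rewrite normr_ge0/= -[v k](subrK 1) addrC.
by apply: le_trans (ler_normD _ _) _; rewrite normr1 lerD2l.
Qed.

Lemma infprod_cvg q C (v : nat -> R) : `|q| < 1 -> 0 <= C ->
  (forall k, `|v k - 1| <= C * `|q| ^+ k) ->
  (fun n => \prod_(k < n) v k) @ \oo --> infprod v.
Proof.
move=> q1 C0 vC; have [K [s [K0 s0 s1 vK]]] := partial_prod_increments q1 C0.
by have [] := geometric_increments K0 (ltW s0) s1 (vK _ vC).
Qed.

(** The reciprocal factors satisfy an estimate of the same form, so their
    product converges too, to an inverse of the limit. *)
Lemma infprod_neq0 q C c (v : nat -> R) : `|q| < 1 -> 0 <= C -> 0 < c ->
  (forall k, `|v k - 1| <= C * `|q| ^+ k) -> (forall k, c <= v k) ->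
  infprod v != 0.
Proof.
move=> q1 C0 c0 vC cv.
have v0 k : 0 < v k by apply: lt_le_trans (cv k).
have wC k : `|(v k)^-1 - 1| <= C / c * `|q| ^+ k.
  have -> : (v k)^-1 - 1 = - (v k - 1) / v k by field; rewrite gt_eqF.
  rewrite normrM normrN mulrAC; apply: ler_pM => //.
  by rewrite gtr0_norm ?invr_gt0// lef_pV2// posrE.
have Cc0 : 0 <= C / c by rewrite divr_ge0// ltW.
have : (fun n => \prod_(k < n) v k * \prod_(k < n) (v k)^-1) @ \oo -->
    infprod v * infprod (fun k => (v k)^-1).
  exact: cvgM (infprod_cvg q1 C0 vC) (infprod_cvg q1 Cc0 wC).
have -> : (fun n => \prod_(k < n) v k * \prod_(k < n) (v k)^-1) = cst (1 : R).
  apply/funext => n /=; rewrite -big_split/= big1// => k _.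
  by rewrite divff// gt_eqF.
move=> /cvg_lim; rewrite lim_cst// => /(_ (@norm_hausdorff _ _)) e1.
by apply/eqP => v00; move: e1; rewrite v00 mul0r => /eqP; rewrite oner_eq0.
Qed.

Lemma qpoch_factor q a k : `|a| < 1 -> `|1 - a * q ^+ k - 1| <= 1 * `|q| ^+ k.
Proof.
move=> a1; rewrite addrAC subrr sub0r normrN normrM normrX.
by apply: ler_wpM2r; rewrite ?exprn_ge0// ltW.
Qed.

Lemma qpoch_cvg q a : `|q| < 1 -> `|a| < 1 ->
  (fun n => \prod_(k < n) (1 - a * q ^+ k)) @ \oo --> qpoch q a.
Proof. by move=> q1 a1; apply: (infprod_cvg q1 ler01) => k; exact: qpoch_factor. Qed.

Lemma qpoch_gt0 q a : `|q| < 1 -> `|a| < 1 -> 0 < qpoch q a.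
Proof.
move=> q1 a1.
have fa k : 1 - `|a| <= 1 - a * q ^+ k.
  rewrite lerD2l lerN2; apply: le_trans (ler_norm _) _.
  by rewrite normrM normrX -[leRHS]mulr1; apply: ler_wpM2l => //; rewrite exprn_ile1// ltW.
have a1' : 0 < 1 - `|a| by rewrite subr_gt0.
rewrite lt_neqAle eq_sym (infprod_neq0 q1 ler01 a1')//=; last by move=> k; exact: qpoch_factor.
apply: limn_ge0 (qpoch_cvg q1 a1) => n.
by apply: prodr_ge0 => k _; apply: le_trans (fa k); exact: ltW.
Qed.
End InfiniteProducts.

(** * Carlitz kernels and the Poisson-Mehler product *)

Section Kernels.
Context {R : realType}.
Variable q : R.
Hypothesis q1 : `|q| < 1.
Implicit Types (rho u v z : R) (i j k : nat).

Definition carlitz rho i j u v : R := limn (series (carlitz_term q rho i j u v)).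

Lemma carlitz_term_sym rho i j u v : carlitz_term q rho i j u v = carlitz_term q rho j i v u.
Proof. by apply/funext => n; rewrite /carlitz_term [X in _ * X]mulrC. Qed.

Lemma carlitz_sym rho i j u v : carlitz rho i j u v = carlitz rho j i v u.
Proof. by rewrite /carlitz carlitz_term_sym. Qed.

(** Uniform convergence on the square [-2, 2]^2, used for the measurability of
    the kernels and for termwise integration. *)
Lemma carlitz_unif rho i j : `|rho| < 1 ->
  exists K s : R, [/\ 0 <= K, 0 < s, s < 1 &
    forall u v, `|u| <= 2 -> `|v| <= 2 ->
     (series (carlitz_term q rho i j u v) @ \oo --> carlitz rho i j u v) /\
     forall n, `|carlitz rho i j u v - series (carlitz_term q rho i j u v) n| <= K * s ^+ n].
Proof.
move=> r1; have [K [s [K0 s0 s1 H]]] := carlitz_term_bound i j q1 r1.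
exists (K / (1 - s)), s; split=> //; first by rewrite divr_ge0// subr_ge0 ltW.
move=> u v u2 v2; apply: geometric_increments => //; first exact: ltW.
by move=> n; rewrite seriesSB/= ; exact: H.
Qed.

Lemma carlitz_cvg rho i j u v : `|rho| < 1 -> `|u| <= 2 -> `|v| <= 2 ->
  series (carlitz_term q rho i j u v) @ \oo --> carlitz rho i j u v.
Proof.
by move=> r1 u2 v2; have [K [s [_ _ _ /(_ u v u2 v2)[]]]] := carlitz_unif i j r1.
Qed.

Lemma carlitz_cvgS rho i j u v : `|rho| < 1 -> `|u| <= 2 -> `|v| <= 2 ->
  (fun n => series (carlitz_term q rho i j u v) n.+1) @ \oo --> carlitz rho i j u v.
Proof.
by move=> r1 u2 v2; have := @carlitz_cvg _ i j _ _ r1 u2 v2; rewrite -cvg_shiftS.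
Qed.

(** The factor 1 - q^n turns (q)_n into (q)_(n-1), which shifts both indices. *)
Lemma carlitz_term_shift rho i j u v n :
  (1 - q ^+ n.+1) * carlitz_term q rho i j u v n.+1 = rho * carlitz_term q rho i.+1 j.+1 u v n.
Proof.
rewrite /carlitz_term qfactS !addnS !addSn (exprS rho); field.
by rewrite !gt_eqF// ?qfact_gt0// onesubX_gt0.
Qed.

(** The recurrence of h produces the coefficient
    1 - q^(n+i) = q^i (1 - q^n) + (1 - q^i).  The first part cancels the last
    factor of (q)_n and shifts the summation index, the second lowers i. *)
Lemma carlitz_term_mulu rho i j u v n :
  u * carlitz_term q rho i j u v n.+1 = carlitz_term q rho i.+1 j u v n.+1
    + q ^+ i * rho * carlitz_term q rho i j.+1 u v n
    + (1 - q ^+ i) * carlitz_term q rho i.-1 j u v n.+1.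
Proof.
have -> : q ^+ i * rho * carlitz_term q rho i j.+1 u v n =
   q ^+ i * (1 - q ^+ n.+1) * (rho ^+ n.+1 / qfact q n.+1 * (qherm q u (n + i) * qherm q v (n.+1 + j))).
  rewrite /carlitz_term qfactS !addnS !addSn (exprS rho); field.
  by rewrite !gt_eqF// ?qfact_gt0// onesubX_gt0.
rewrite /carlitz_term [(n.+1 + i.+1)%N]addnS qhermS [(n.+1 + i).-1]/=.
have -> : q ^+ (n.+1 + i) = q ^+ n.+1 * q ^+ i by rewrite exprD.
case: i => [|i] /=; first by rewrite expr0 addn0; ring.
by rewrite !addSn !addnS; ring.
Qed.

(** [carlitz_term_mulu] summed over n, with the limits taken along shifted
    partial sums.  At i = 0 the last term is absent, its coefficient being 0. *)
Lemma carlitz_mulu rho i j u v : `|rho| < 1 -> `|u| <= 2 -> `|v| <= 2 ->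
  u * carlitz rho i j u v = carlitz rho i.+1 j u v + q ^+ i * rho * carlitz rho i j.+1 u v
    + (1 - q ^+ i) * carlitz rho i.-1 j u v.
Proof.
move=> r1 u2 v2; pose S i j := series (carlitz_term q rho i j u v).
have SE n : u * S i j n.+1 = S i.+1 j n.+1 + q ^+ i * rho * S i j.+1 n
    + (1 - q ^+ i) * S i.-1 j n.+1.
  rewrite /S /series/= !big_nat_recl//= !mulrDr.
  have -> : u * (\sum_(0 <= m < n) carlitz_term q rho i j u v m.+1) =
      \sum_(0 <= m < n) carlitz_term q rho i.+1 j u v m.+1
      + q ^+ i * rho * (\sum_(0 <= m < n) carlitz_term q rho i j.+1 u v m)
      + (1 - q ^+ i) * (\sum_(0 <= m < n) carlitz_term q rho i.-1 j u v m.+1).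
    by rewrite !mulr_sumr -!big_split/=; apply: eq_bigr => m _; exact: carlitz_term_mulu.
  have -> : u * carlitz_term q rho i j u v 0 = carlitz_term q rho i.+1 j u v 0
     + (1 - q ^+ i) * carlitz_term q rho i.-1 j u v 0.
    rewrite /carlitz_term !add0n qhermS; ring.
  ring.
apply: (limn_eq SE).
  by apply: cvgM; [exact: cvg_cst|exact: carlitz_cvgS].
by apply: cvgD; [apply: cvgD; [exact: carlitz_cvgS|]|];
  (apply: cvgM; [exact: cvg_cst|]); [exact: carlitz_cvg|exact: carlitz_cvgS].
Qed.

Lemma carlitz_mulv rho i j u v : `|rho| < 1 -> `|u| <= 2 -> `|v| <= 2 ->
  v * carlitz rho i j u v = carlitz rho i j.+1 u v + q ^+ j * rho * carlitz rho i.+1 j u v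
    + (1 - q ^+ j) * carlitz rho i j.-1 u v.
Proof.
by move=> r1 u2 v2; rewrite carlitz_sym carlitz_mulu// [carlitz _ j.+1 _ _ _]carlitz_sym
  [carlitz _ j i.+1 _ _]carlitz_sym [carlitz _ j.-1 _ _ _]carlitz_sym.
Qed.

Definition mehler rho u v : R := carlitz rho 0 0 u v.

(** omega_q(x, y | rho) in the rescaled variables. *)
Definition omega u v rho : R := (1 - rho ^+ 2) ^+ 2 - u * v * rho * (1 + rho ^+ 2)
  + rho ^+ 2 * (u ^+ 2 + v ^+ 2).

Lemma oneB_neq0 (x : R) : `|x| < 1 -> 1 - x != 0.
Proof. by move=> x1; rewrite gt_eqF// subr_gt0 (le_lt_trans (ler_norm _)). Qed.

Lemma normX2_lt1 rho k : `|rho| < 1 -> `|q ^+ k * rho ^+ 2| < 1.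
Proof.
move=> r1; rewrite normrM !normrX; apply: (@le_lt_trans _ _ (`|rho| ^+ 2)).
  by rewrite ler_piMl ?exprn_ge0// exprn_ile1// ltW.
by rewrite exprn_ilt1.
Qed.

Lemma carlitz_01 rho u v : `|rho| < 1 -> `|u| <= 2 -> `|v| <= 2 ->
  (1 - rho ^+ 2) * carlitz rho 0 1 u v = (v - rho * u) * mehler rho u v.
Proof.
move=> r1 u2 v2; have := carlitz_mulu 0 0 r1 u2 v2; have := carlitz_mulv 0 0 r1 u2 v2.
rewrite expr0 subrr !mul0r !addr0 !mul1r -/(mehler rho u v) => e2 e1.
have -> : (v - rho * u) * mehler rho u v = v * mehler rho u v - rho * (u * mehler rho u v) by ring.
by rewrite e1 e2; ring.
Qed.

Lemma carlitz_11 rho u v : `|rho| < 1 -> `|u| <= 2 -> `|v| <= 2 ->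
  (1 - rho ^+ 2) * (1 - q * rho ^+ 2) * carlitz rho 1 1 u v =
  ((u - rho * v) * (v - rho * u) + rho * (1 - q) * (1 - rho ^+ 2)) * mehler rho u v.
Proof.
move=> r1 u2 v2; have := carlitz_mulu 0 1 r1 u2 v2; have := carlitz_mulv 0 1 r1 u2 v2.
rewrite expr0 expr1 subrr mul0r addr0 mul1r /= -/(mehler rho u v).
set g02 := carlitz _ 0 2 _ _; set g11 := carlitz _ 1 1 _ _ => e1 e2.
have e3 := carlitz_01 r1 u2 v2.
rewrite [RHS]mulrDl -[X in _ = X + _]mulrA -e3.
have -> : (u - rho * v) * ((1 - rho ^+ 2) * carlitz rho 0 1 u v) =
  (1 - rho ^+ 2) * (u * carlitz rho 0 1 u v - rho * (v * carlitz rho 0 1 u v)) by ring.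
rewrite e1 e2; ring.
Qed.

(** Term by term, q^n = 1 - (1 - q^n) shows that replacing rho by rho q
    subtracts rho C_11 from C_00; and C_11 is a multiple of C_00 by
    [carlitz_11].  This q-difference equation turns the series into a
    product. *)
Lemma mehler_qshift rho u v : `|rho| < 1 -> `|u| <= 2 -> `|v| <= 2 ->
  omega u v rho * mehler rho u v =
  (1 - rho ^+ 2) * (1 - q * rho ^+ 2) * mehler (rho * q) u v.
Proof.
move=> r1 u2 v2.
have rq1 : `|rho * q| < 1 by rewrite normrM mulr_ilt1.
have e : mehler (rho * q) u v = mehler rho u v - rho * carlitz rho 1 1 u v.
  apply: (@limn_eq _ (fun n => series (carlitz_term q (rho * q) 0 0 u v) n.+1)
    (fun n => series (carlitz_term q rho 0 0 u v) n.+1 - rho * series (carlitz_term q rho 1 1 u v) n)).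
  - move=> n.
    rewrite /series/= !big_nat_recl//= -addrA; congr +%R.
    rewrite mulr_sumr -sumrB; apply: eq_bigr => m _.
    rewrite -carlitz_term_shift.
    have -> : carlitz_term q (rho * q) 0 0 u v m.+1 = q ^+ m.+1 * carlitz_term q rho 0 0 u v m.+1.
      by rewrite /carlitz_term exprMn; ring.
    by ring.
  - exact: carlitz_cvgS.
  - apply: cvgB; first exact: carlitz_cvgS.
    by apply: cvgM; [exact: cvg_cst|exact: carlitz_cvg].
rewrite e mulrBr.
have -> : (1 - rho ^+ 2) * (1 - q * rho ^+ 2) * (rho * carlitz rho 1 1 u v) =
  rho * ((1 - rho ^+ 2) * (1 - q * rho ^+ 2) * carlitz rho 1 1 u v) by ring.
by rewrite carlitz_11// /omega; ring.
Qed.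

(** Every term after the first carries a factor q^N. *)
Lemma mehler_cvg1 rho u v : `|rho| < 1 -> `|u| <= 2 -> `|v| <= 2 ->
  (fun N => mehler (rho * q ^+ N) u v) @ \oo --> (1 : R).
Proof.
move=> r1 u2 v2; have [K [s [K0 s0 s1 H]]] := carlitz_term_bound 0 0 q1 r1.
have s1' : 0 < 1 - s by rewrite subr_gt0.
apply: (@squeeze_dist _ _ (fun N => K / (1 - s) * `|q| ^+ N)); last first.
  by apply: cvg_geometric0; rewrite normr_id.
move=> N; have rq1 : `|rho * q ^+ N| < 1.
  rewrite normrM; apply: le_lt_trans r1; rewrite ler_piMr// normrX.
  by rewrite exprn_ile1// ltW.
apply: (@limn_norm_le _ (fun n => series (carlitz_term q (rho * q ^+ N) 0 0 u v) n.+1 - 1)); last first.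
  by apply: cvgB; [exact: carlitz_cvgS|exact: cvg_cst].
move=> M; rewrite /series/= big_nat_recl//=.
rewrite {1}/carlitz_term expr0 /qfact big_ord0 !qherm0 !mulr1 divr1 addrAC subrr add0r.
apply: le_trans (ler_norm_sum _ _ _) _.
apply: (@le_trans _ _ (\sum_(0 <= n < M) `|q| ^+ N * (K * s ^+ n))).
  apply: ler_sum => n _.
  have -> : carlitz_term q (rho * q ^+ N) 0 0 u v n.+1 =
     q ^+ N * (q ^+ (N * n) * carlitz_term q rho 0 0 u v n.+1).
    by rewrite /carlitz_term exprMn -exprM mulnS exprD; ring.
  rewrite normrM normrX; apply: ler_wpM2l; first by rewrite exprn_ge0.
  rewrite normrM normrX; apply: le_trans (ler_piMl _ _) _ => //.
    by rewrite exprn_ile1// ltW.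
  apply: le_trans (H u v n.+1 u2 v2) _; apply: ler_wpM2l => //.
  by rewrite exprS ler_piMl ?exprn_ge0// ltW.
rewrite -!mulr_sumr [leRHS]mulrC; apply: ler_wpM2l; first by rewrite exprn_ge0.
apply: ler_wpM2l => //.
have := @geometric_le_lim R M 1 s ler01 s0; rewrite gtr0_norm// => /(_ s1).
by rewrite /series/= div1r; under eq_bigr do rewrite mul1r.
Qed.

(** N steps of [mehler_qshift].  Each step contributes two consecutive factors
    of the Pochhammer symbol (rho^2; q), hence the 2 N factors on the right. *)
Lemma prod_omega rho u v N : `|rho| < 1 -> `|u| <= 2 -> `|v| <= 2 ->
  \prod_(k < N) omega u v (rho * q ^+ k) * mehler rho u v =
  \prod_(k < N.*2) (1 - rho ^+ 2 * q ^+ k) * mehler (rho * q ^+ N) u v.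
Proof.
move=> r1 u2 v2; elim: N => [|N IH]; first by rewrite !big_ord0 expr0 mulr1.
have rq1 : `|rho * q ^+ N| < 1.
  rewrite normrM; apply: le_lt_trans r1; rewrite ler_piMr// normrX.
  by rewrite exprn_ile1// ltW.
have := mehler_qshift rq1 u2 v2.
have -> : rho * q ^+ N * q = rho * q ^+ N.+1 by rewrite exprSr mulrA.
rewrite doubleS !big_ord_recr/=; move: IH.
set A := \prod_(k < N) _; set B := \prod_(k < N.*2) _ => IH e.
have -> : A * omega u v (rho * q ^+ N) * mehler rho u v =
  omega u v (rho * q ^+ N) * (A * mehler rho u v) by ring.
rewrite IH mulrCA e.
have -> : q ^+ N.*2 = q ^+ N * q ^+ N by rewrite -addnn exprD.
have -> : q ^+ N.*2.+1 = q * (q ^+ N * q ^+ N) by rewrite -addnn exprS exprD.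
ring.
Qed.

(** The Poisson-Mehler formula.  The kernel cannot vanish: otherwise the left
    side of [prod_omega] would be 0 for all N, while its right side tends to
    (rho^2; q)_oo, which is positive. *)
Lemma mehler_product rho u v : `|rho| < 1 -> `|u| <= 2 -> `|v| <= 2 ->
  mehler rho u v != 0 /\
  (fun N => \prod_(k < N) omega u v (rho * q ^+ k)) @ \oo -->
     qpoch q (rho ^+ 2) / mehler rho u v.
Proof.
move=> r1 u2 v2.
have r21 : `|rho ^+ 2| < 1 by rewrite normrX exprn_ilt1.
have p0 := qpoch_gt0 q1 r21.
have c2 : (fun N => \prod_(k < N.*2) (1 - rho ^+ 2 * q ^+ k)) @ \oo --> qpoch q (rho ^+ 2).
  rewrite (_ : (fun N => _) = (fun n => \prod_(k < n) (1 - rho ^+ 2 * q ^+ k)) \o muln 2).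
    by apply: cvg_comp (qpoch_cvg q1 r21); exact: cvg_mulnl.
  by apply/funext => N /=; rewrite mul2n.
have cr : (fun N => \prod_(k < N.*2) (1 - rho ^+ 2 * q ^+ k) * mehler (rho * q ^+ N) u v)
    @ \oo --> qpoch q (rho ^+ 2).
  by rewrite -[X in _ --> X]mulr1; exact: cvgM c2 (mehler_cvg1 r1 u2 v2).
have PN0 : mehler rho u v != 0.
  apply/eqP => P0; move: cr.
  under eq_fun do rewrite -prod_omega// P0 mulr0.
  move=> /cvg_lim; rewrite lim_cst// => /(_ (@norm_hausdorff _ _)) e.
  by move: p0; rewrite -e ltxx.
split=> //.
have -> : (fun N => \prod_(k < N) omega u v (rho * q ^+ k)) = (fun N =>
    \prod_(k < N.*2) (1 - rho ^+ 2 * q ^+ k) * mehler (rho * q ^+ N) u v / mehler rho u v).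
  by apply/funext => N; rewrite -prod_omega// mulfK.
by apply: cvgM; [exact: cr|exact: cvg_cst].
Qed.

End Kernels.

(** * Spans of Carlitz kernels *)

Section KernelSpan.
Context {R : realType}.
Variable q : R.
Hypothesis q1 : `|q| < 1.
Implicit Types (rho u v z c : R) (i j k n : nat).
Local Notation carlitz := (carlitz q).
Local Notation mehler := (mehler q).

Definition carlitz_span rho k (F : R -> R -> R) :=
  exists s : seq (R * (nat * nat)),
    all (fun x => x.2.1 + x.2.2 <= k)%N s /\
    forall u v, `|u| <= 2 -> `|v| <= 2 ->
      F u v = \sum_(x <- s) x.1 * carlitz rho x.2.1 x.2.2 u v.

Lemma carlitz_span_ext rho k F G :
  (forall u v, `|u| <= 2 -> `|v| <= 2 -> F u v = G u v) ->
  carlitz_span rho k G -> carlitz_span rho k F.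
Proof. by move=> FG [s [sk sE]]; exists s; split=> // u v u2 v2; rewrite FG// sE. Qed.

Lemma carlitz_span0 rho k : carlitz_span rho k (fun _ _ => 0).
Proof. by exists [::]; split=> // u v _ _; rewrite big_nil. Qed.

Lemma carlitz_span_carlitz rho k i j : (i + j <= k)%N -> carlitz_span rho k (carlitz rho i j).
Proof.
move=> ijk; exists [:: (1, (i, j))]; split=> /=; first by rewrite ijk.
by move=> u v _ _; rewrite big_seq1 mul1r.
Qed.

Lemma carlitz_span_lin rho k c F G : carlitz_span rho k F -> carlitz_span rho k G ->
  carlitz_span rho k (fun u v => c * F u v + G u v).
Proof.
move=> [s [sk sE]] [t [tk tE]].
exists ([seq (c * x.1, x.2) | x <- s] ++ t); split.
  by rewrite all_cat tk andbT all_map.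
move=> u v u2 v2; rewrite big_cat big_map/= sE// tE// mulr_sumr.
by congr +%R; apply: eq_bigr => x _; rewrite mulrA.
Qed.

Lemma carlitz_span_mono rho k l F : (k <= l)%N -> carlitz_span rho k F -> carlitz_span rho l F.
Proof.
move=> kl [s [sk sE]]; exists s; split=> //.
by apply: sub_all sk => x /leq_trans; apply.
Qed.

Lemma carlitz_span_sum rho k (I : Type) (s : seq I) (P : pred I) (c : I -> R) (F : I -> R -> R -> R) :
  (forall x, P x -> carlitz_span rho k (F x)) -> all P s ->
  carlitz_span rho k (fun u v => \sum_(x <- s) c x * F x u v).
Proof.
move=> PF; elim: s => [_|x s IH /=/andP[Px Ps]].
  by apply: (carlitz_span_ext _ (carlitz_span0 _ _)) => u v _ _; rewrite big_nil.
apply: (carlitz_span_ext _ (carlitz_span_lin (c x) (PF _ Px) (IH Ps))) => u v _ _.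
by rewrite big_cons.
Qed.

Lemma carlitz_span_mulu rho k F : `|rho| < 1 -> carlitz_span rho k F ->
  carlitz_span rho k.+1 (fun u v => u * F u v).
Proof.
move=> r1 [s [sk sE]].
apply: (@carlitz_span_ext _ _ _ (fun u v => \sum_(x <- s)
   x.1 * (u * carlitz rho x.2.1 x.2.2 u v))).
  by move=> u v u2 v2; rewrite sE// mulr_sumr; apply: eq_bigr => x _; rewrite mulrCA.
apply: carlitz_span_sum sk => -[_ [i j]] /= ijk.
apply: (@carlitz_span_ext _ _ _ (fun u v => 1 * carlitz rho i.+1 j u v +
   (q ^+ i * rho * carlitz rho i j.+1 u v + ((1 - q ^+ i) * carlitz rho i.-1 j u v + 0)))).
  by move=> u v u2 v2; rewrite carlitz_mulu// mul1r addr0 addrA.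
do 3 (apply: carlitz_span_lin; first by apply: carlitz_span_carlitz; lia).
exact: carlitz_span0.
Qed.

(** Each multiplication by u raises the order by at most one, by [carlitz_mulu];
    the recurrence of h then gives the claim for h_n(u). *)
Lemma carlitz_span_qherm rho k n F : `|rho| < 1 -> carlitz_span rho k F ->
  carlitz_span rho (k + n) (fun u v => qherm q u n * F u v).
Proof.
move=> r1 kF; have [m] := ubnP n; elim: m n => // m IH [_|n nm].
  rewrite addn0; apply: (carlitz_span_ext _ kF) => u v _ _; by rewrite qherm0 mul1r.
apply: (@carlitz_span_ext _ _ _ (fun u v => - (1 - q ^+ n) * (qherm q u n.-1 * F u v) +
   (u * (qherm q u n * F u v)))).
  by move=> u v _ _; rewrite qhermS; ring.
apply: carlitz_span_lin; last by rewrite addnS; apply: carlitz_span_mulu => //; apply: IH.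
by apply: (carlitz_span_mono _ (IH n.-1 _)); lia.
Qed.

Definition diag_poly rho k (G : R -> R) := exists p : {poly R},
  (size p <= k.+1)%N /\ forall z, `|z| <= 2 -> G z = p.[z] * mehler rho z z.

Lemma diag_poly_lin rho k c F G : diag_poly rho k F -> diag_poly rho k G ->
  diag_poly rho k (fun z => c * F z + G z).
Proof.
move=> [p [sp pE]] [r [sr rE]]; exists (c *: p + r); split.
  apply: leq_trans (size_polyD _ _) _; rewrite geq_max sr andbT.
  exact: leq_trans (size_scale_leq _ _) _.
by move=> z z2; rewrite pE// rE// hornerD hornerZ mulrDl mulrA.
Qed.

Lemma diag_poly0 rho k : diag_poly rho k (fun _ => 0).
Proof. by exists 0; split=> [|z _]; rewrite ?size_poly0// horner0 mul0r. Qed.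

Lemma diag_poly_ext rho k F G : (forall z, `|z| <= 2 -> F z = G z) ->
  diag_poly rho k G -> diag_poly rho k F.
Proof. by move=> FG [p [sp pE]]; exists p; split=> // z z2; rewrite FG// pE. Qed.

Lemma diag_poly_mulX rho k F : diag_poly rho k F -> diag_poly rho k.+1 (fun z => z * F z).
Proof.
move=> [p [sp pE]]; exists ('X * p); split.
  by apply: leq_trans (size_polyMleq _ _) _; rewrite size_polyX.
by move=> z z2; rewrite pE// hornerM hornerX mulrA.
Qed.

Lemma diag_poly_mono rho k l F : (k <= l)%N -> diag_poly rho k F -> diag_poly rho l F.
Proof.
move=> kl [p [sp pE]]; exists p; split=> //.
by apply: leq_trans sp _; rewrite ltnS.
Qed.

(** Combining the relations for u and for v at u = v = z eliminates C_(i,j+1)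
    and expresses (1 - q^(i+j) rho^2) C_(i+1,j) through z C_ij and kernels of
    order i + j - 1.  Kernels with i = 0 are covered by the symmetry in
    i and j on the diagonal. *)
Lemma diag_poly_carlitz rho i j : `|rho| < 1 ->
  diag_poly rho (i + j) (fun z => carlitz rho i j z z).
Proof.
move=> r1; have [m] := ubnP (i + j); elim: m i j => // m IH.
have base : diag_poly rho 0 (fun z => carlitz rho 0 0 z z).
  by exists 1; split=> [|z z2]; rewrite ?size_polyC ?oner_eq0// hornerE mul1r.
have step i j : (i + j < m)%N -> diag_poly rho (i.+1 + j) (fun z => carlitz rho i.+1 j z z).
  move=> ijm; set D := 1 - q ^+ (i + j) * rho ^+ 2.
  have D0 : D != 0 by apply: oneB_neq0; apply: normX2_lt1.
  apply: (@diag_poly_ext _ _ _ (fun z => ((1 - q ^+ i * rho) / D) * (z * carlitz rho i j z z)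
     + (- ((1 - q ^+ i) / D) * carlitz rho i.-1 j z z
       + ((q ^+ i * rho * (1 - q ^+ j) / D) * carlitz rho i j.-1 z z
        + 0)))).
    move=> z z2; have e1 := carlitz_mulu q1 i j r1 z2 z2; have e2 := carlitz_mulv q1 i j r1 z2 z2.
    apply: (mulfI D0).
    have -> : D * carlitz rho i.+1 j z z = (carlitz rho i.+1 j z z + q ^+ i * rho * carlitz rho i j.+1 z z
      + (1 - q ^+ i) * carlitz rho i.-1 j z z)
      - q ^+ i * rho * (carlitz rho i j.+1 z z + q ^+ j * rho * carlitz rho i.+1 j z z
        + (1 - q ^+ j) * carlitz rho i j.-1 z z)
      - (1 - q ^+ i) * carlitz rho i.-1 j z z
      + q ^+ i * rho * (1 - q ^+ j) * carlitz rho i j.-1 z z.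
      by rewrite /D exprD; ring.
    by rewrite -e1 -e2; field.
  apply: diag_poly_lin; first by rewrite addSn; apply: diag_poly_mulX; apply: IH; lia.
  have low a b : (a + b <= i + j)%N -> diag_poly rho (i.+1 + j) (fun z => carlitz rho a b z z).
    by move=> abij; apply: (@diag_poly_mono rho (a + b)); [lia|apply: IH; lia].
  apply: diag_poly_lin; first by apply: low; lia.
  by apply: diag_poly_lin; [apply: low; lia|exact: diag_poly0].
move=> [|i] j; last by move=> ijm; apply: step.
case: j => [_|j jm]; first exact: base.
apply: (@diag_poly_ext _ _ _ (fun z => carlitz rho j.+1 0 z z)).
  by move=> z _; rewrite carlitz_sym.
by rewrite addnC; apply: step; rewrite addn0.
Qed.

Lemma diag_poly_carlitz_span rho k F : `|rho| < 1 -> carlitz_span rho k F ->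
  diag_poly rho k (fun z => F z z).
Proof.
move=> r1 [s [sk sE]].
apply: (@diag_poly_ext _ _ _ (fun z => \sum_(x <- s) x.1 * carlitz rho x.2.1 x.2.2 z z)).
  by move=> z z2; rewrite sE.
elim: s sk {sE} => [_|x s IH /=/andP[xk sk]].
  by apply: (diag_poly_ext _ (diag_poly0 _ _)) => z _; rewrite big_nil.
apply: (@diag_poly_ext _ _ _ (fun z => x.1 * carlitz rho x.2.1 x.2.2 z z
   + \sum_(x <- s) x.1 * carlitz rho x.2.1 x.2.2 z z)).
  by move=> z _; rewrite big_cons.
apply: diag_poly_lin; last exact: IH.
exact: diag_poly_mono xk (diag_poly_carlitz _ _ r1).
Qed.

End KernelSpan.

(** * Bounded measurable functions *)

Section BoundedMeasurable.
Context d (T : measurableType d) (R : realType).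
Implicit Types (D : set T) (F G : T -> R).

(** On sets of finite measure these functions are integrable; unlike
    integrability, the notion is stable under products and under restriction to
    every section of a product set. *)
Definition bddmeas D F := measurable_fun D F /\ exists M, forall x, D x -> `|F x| <= M.

Lemma bddmeas_cst D c : bddmeas D (fun _ => c).
Proof. by split; [exact: measurable_cst|exists `|c|]. Qed.

Lemma bddmeasD D F G : bddmeas D F -> bddmeas D G -> bddmeas D (fun x => F x + G x).
Proof.
move=> [mF [M FM]] [mG [N GN]]; split; first exact: measurable_funD.
by exists (M + N) => x Dx; apply: le_trans (ler_normD _ _) _; apply: lerD; auto.
Qed.

Lemma bddmeasM D F G : bddmeas D F -> bddmeas D G -> bddmeas D (fun x => F x * G x).
Proof.
move=> [mF [M FM]] [mG [N GN]]; split; first exact: measurable_funM.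
by exists (M * N) => x Dx; rewrite normrM; apply: ler_pM; auto.
Qed.

Lemma bddmeasZ D c F : bddmeas D F -> bddmeas D (fun x => c * F x).
Proof. exact/bddmeasM/bddmeas_cst. Qed.

Lemma bddmeasB D F G : bddmeas D F -> bddmeas D G -> bddmeas D (fun x => F x - G x).
Proof.
move=> bF bG; have := bddmeasD bF (bddmeasZ (-1) bG).
by under [X in bddmeas D X -> _]eq_fun do rewrite mulN1r.
Qed.

Lemma bddmeas_sum D (I : Type) (s : seq I) (P : pred I) (F : I -> T -> R) :
  (forall i, bddmeas D (F i)) -> bddmeas D (fun x => \sum_(i <- s | P i) F i x).
Proof.
move=> bF; elim: s => [|i s IH].
  by under eq_fun do rewrite big_nil; exact: bddmeas_cst.
under eq_fun do rewrite big_cons; case: (P i) => //; exact: bddmeasD.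
Qed.

Lemma bddmeas_prod D (I : Type) (s : seq I) (F : I -> T -> R) :
  (forall i, bddmeas D (F i)) -> bddmeas D (fun x => \prod_(i <- s) F i x).
Proof.
move=> bF; elim: s => [|i s IH].
  by under eq_fun do rewrite big_nil; exact: bddmeas_cst.
by under eq_fun do rewrite big_cons; exact: bddmeasM.
Qed.

Lemma bddmeas_ext D F G : (forall x, D x -> F x = G x) -> bddmeas D G -> bddmeas D F.
Proof.
move=> FG [mG [M GM]]; split; last by exists M => x Dx; rewrite FG//; exact: GM.
by apply: eq_measurable_fun mG => x /[1!inE] Dx; rewrite FG.
Qed.

Lemma bddmeas_unif D (F_ : nat -> T -> R) F (e : nat -> R) :
  (forall n, bddmeas D (F_ n)) -> (forall n x, D x -> `|F x - F_ n x| <= e n) ->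
  e @ \oo --> (0 : R) -> bddmeas D F.
Proof.
move=> bF Fe e0; split.
  apply: (@measurable_fun_cvg _ _ _ _ F_); first by move=> n; exact: (bF n).1.
  by move=> x Dx; apply: squeeze_dist e0 => n; rewrite distrC; exact: Fe.
have [_ [M FM]] := bF 0%N; exists (e 0%N + M) => x Dx.
rewrite -[F x](subrK (F_ 0%N x)); apply: le_trans (ler_normD _ _) _.
by apply: lerD; auto.
Qed.

Variable mu : {measure set T -> \bar R}.

Section OnD.
Variable D : set T.
Hypotheses (mD : measurable D) (muD : (mu D < +oo)%E).

Lemma bddmeas_integrable F : bddmeas D F -> mu.-integrable D (EFin \o F).
Proof.
move=> [mF [M FM]]; apply: measurable_bounded_integrable => //.
by exists M; split; [exact: num_real|move=> x Mx t Dt; apply: le_trans (FM t Dt) (ltW Mx)].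
Qed.

Lemma Rint_lin c F G : bddmeas D F -> bddmeas D G ->
  \int[mu]_(x in D) (c * F x + G x) = c * \int[mu]_(x in D) F x + \int[mu]_(x in D) G x.
Proof.
move=> bF bG; rewrite RintegralD//; [|exact/bddmeas_integrable/bddmeasZ|exact: bddmeas_integrable].
by rewrite RintegralZl//; exact: bddmeas_integrable.
Qed.

Lemma Rint_sum (I : Type) (s : seq I) (c : I -> R) (F : I -> T -> R) :
  (forall i, bddmeas D (F i)) ->
  \int[mu]_(x in D) (\sum_(i <- s) c i * F i x) =
  \sum_(i <- s) c i * \int[mu]_(x in D) F i x.
Proof.
move=> bF; elim: s => [|i s IH].
  rewrite big_nil; under eq_Rintegral do rewrite big_nil.
  by rewrite Rintegral_cst// mul0r.
rewrite big_cons -IH -Rint_lin//; first by apply: eq_Rintegral => x _; rewrite big_cons.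
by apply: bddmeas_sum => j; exact: bddmeasZ.
Qed.

Lemma Rint_ext F G : (forall x, D x -> F x = G x) ->
  \int[mu]_(x in D) F x = \int[mu]_(x in D) G x.
Proof. by move=> FG; apply: eq_Rintegral => x /[1!inE]; exact: FG. Qed.

(** Uniform limits can be integrated; all the exchanges of limits and integrals
    below are of this kind. *)
Lemma Rint_unif (F_ : nat -> T -> R) F (e : nat -> R) :
  (forall n, bddmeas D (F_ n)) -> (forall n x, D x -> `|F x - F_ n x| <= e n) ->
  e @ \oo --> (0 : R) ->
  (fun n => \int[mu]_(x in D) F_ n x) @ \oo --> \int[mu]_(x in D) F x.
Proof.
move=> bF Fe e0; have bG := bddmeas_unif bF Fe e0.
apply: (@squeeze_dist _ _ (fun n => e n * fine (mu D))); last first.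
  by rewrite -[X in _ --> X](mul0r (fine (mu D))); apply: cvgM => //; exact: cvg_cst.
move=> n; have bB := bddmeasB (bF n) bG.
rewrite -(RintegralB mD); [|exact: bddmeas_integrable|exact: bddmeas_integrable].
apply: le_trans (le_normr_Rintegral mD _) _; first exact: bddmeas_integrable.
rewrite -(Rintegral_cst mu mD); apply: le_Rintegral => //.
- by apply: bddmeas_integrable; split; [exact: measurableT_comp bB.1|
    have [_ [M MB]] := bB; exists M => x Dx; rewrite normr_id; exact: MB].
- exact/bddmeas_integrable/bddmeas_cst.
- by move=> x Dx; rewrite distrC; exact: Fe.
Qed.

Lemma EFin_Rint F : bddmeas D F ->
  (\int[mu]_(x in D) (F x)%:E = (\int[mu]_(x in D) F x)%:E)%E.
Proof.
by move=> /bddmeas_integrable iF; rewrite /Rintegral fineK//; exact: integrable_fin_num.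
Qed.

End OnD.
End BoundedMeasurable.

Lemma bddmeas_comp d1 d2 (T1 : measurableType d1) (T2 : measurableType d2) (R : realType)
  (D1 : set T1) (D2 : set T2) (f : T1 -> T2) (F : T2 -> R) :
  measurable D2 -> measurable_fun D1 f -> (forall x, D1 x -> D2 (f x)) -> bddmeas D2 F ->
  bddmeas D1 (F \o f).
Proof.
move=> mD2 mf fD [mF [M FM]]; split; last by exists M => x /fD; exact: FM.
by apply: (measurable_comp mD2) => // _ [x /fD ? <-].
Qed.

(** * Chebyshev polynomials against the semicircle *)

Section ChebyshevIntegral.
Context {R : realType}.
Implicit Types (u x : R) (n : nat).

(** The usual formula for the derivative involves the polynomial of index n - 1;
    in terms of the one of index n + 1 it also covers n = 0. *)
Lemma is_derive_cheb u n : 4 - u ^+ 2 != 0 ->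
  is_derive u 1 (fun u => cheb u n)
    ((n.+2%:R * u * cheb u n - 2 * n.+1%:R * cheb u n.+1) / (4 - u ^+ 2)).
Proof.
move=> u0; pose D n := (n.+2%:R * u * cheb u n - 2 * n.+1%:R * cheb u n.+1) / (4 - u ^+ 2).
rewrite -/(D n); suff : is_derive u 1 (fun u => cheb u n) (D n) /\
  is_derive u 1 (fun u => cheb u n.+1) (D n.+1) by case.
elim: n => [|n [IH1 IH2]].
  split.
    rewrite (_ : (fun u => _) = cst 1); last by apply/funext => v; rewrite cheb0.
    apply: is_derive_eq; rewrite /D cheb0 cheb1; field.
    by [].
  rewrite (_ : (fun u => _) = id); last by apply/funext => v; rewrite cheb1.
  apply: is_derive_eq; rewrite /D chebSS cheb0 cheb1; field.
  by [].
split=> //.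
rewrite (_ : (fun u => _) = id * (fun u => cheb u n.+1) - (fun u => cheb u n)); last first.
  by apply/funext => v; rewrite chebSS.
apply: is_derive_eq; rewrite /GRing.scale/= /D !chebSS -![n.+4%:R]natr1 -![n.+3%:R]natr1 -![n.+2%:R]natr1 -natr1.
by field.
Qed.

(** With u = 2 cos t this is 2 sin((n+3) t) / (n+3) - 2 sin((n+1) t) / (n+1). *)
Definition cheb_primitive n u :=
  Num.sqrt (4 - u ^+ 2) * (cheb u n.+2 / n.+3%:R - cheb u n / n.+1%:R).

Lemma is_derive_cheb_primitive n u : 0 < 4 - u ^+ 2 ->
  is_derive u 1 (cheb_primitive n) (cheb u n.+1 * Num.sqrt (4 - u ^+ 2)).
Proof.
move=> u0; have u0' : 4 - u ^+ 2 != 0 by rewrite gt_eqF.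
have d1 := is_derive_cheb n u0'; have d2 := is_derive_cheb n.+2 u0'.
have ds : is_derive u 1 (Num.sqrt \o (fun u : R => 4 - u ^+ 2))
    ((2 * Num.sqrt (4 - u ^+ 2))^-1 * (- (2 * u))).
  apply: is_derive1_comp; first exact: is_derive1_sqrt.
  rewrite (_ : (fun u => _) = cst 4 - (fun u : R => u) ^+ 2); last by apply/funext.
  by apply: is_derive_eq; rewrite /GRing.scale/=; ring.
have -> : cheb_primitive n = (Num.sqrt \o (fun u : R => 4 - u ^+ 2)) *
    ((n.+3%:R^-1 \*: (fun u => cheb u n.+2)) - (n.+1%:R^-1 \*: (fun u => cheb u n))).
  by apply/funext => v; rewrite /cheb_primitive ![_ / _%:R]mulrC.
apply: is_derive_eq; rewrite /GRing.scale/=.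
set a := cheb u n; set b := cheb u n.+1.
have -> : cheb u n.+2 = u * b - a by rewrite chebSS.
have -> : cheb u n.+3 = u * (u * b - a) - b by rewrite !chebSS.
have s2 : Num.sqrt (4 - u ^+ 2) ^+ 2 = 4 - u ^+ 2 by rewrite sqr_sqrtr// ltW.
have s0 : Num.sqrt (4 - u ^+ 2) != 0 by rewrite gt_eqF// sqrtr_gt0.
apply: (mulfI s0); move: s2 s0; set s := Num.sqrt _ => s2 s0.
have -> : (n.+3%:R^-1 \*: (fun u => cheb u n.+2) - n.+1%:R^-1 \*: (fun u => cheb u n)) u =
  n.+3%:R^-1 * (u * b - a) - n.+1%:R^-1 * a by rewrite /b /a -chebSS.
rewrite mulrDr mulrA -expr2 s2.
set B := _ - _ * a; set A := _ * (_ / _) - _ * _.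
have -> : s * (B * ((2 * s)^-1 * - (2 * u))) = - (u * B) by field.
have -> : s * (b * s) = b * (4 - u ^+ 2) by rewrite -s2; ring.
rewrite /A /B -[n.+4%:R]natr1 -![n.+3%:R]natr1 -![n.+2%:R]natr1.
have n1 : n.+1%:R != 0 :> R by rewrite pnatr_eq0.
have n3 : n.+1%:R + 1 + 1 != 0 :> R by rewrite !natr1 pnatr_eq0.
move: n1 n3; move: (n.+1%:R : R) => N n1 n3.
by field; rewrite u0' n1 n3.
Qed.

Lemma qherm_continuous (q : R) n : continuous (fun u : R => qherm q u n).
Proof.
have [m] := ubnP n; elim: m n => // m IH [_|n nm].
  by rewrite (_ : (fun u => _) = cst 1); [exact: cst_continuous|apply/funext => u; rewrite qherm0].
rewrite (_ : (fun u => _) = (fun u => u * qherm q u n - (1 - q ^+ n) * qherm q u n.-1)).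
  move=> u; apply: cvgB; first by apply: cvgM; [exact: cvg_id|apply: IH].
  by apply: cvgM; [exact: cvg_cst|apply: IH; lia].
by apply/funext => u; rewrite qhermS.
Qed.

Lemma cheb_primitive_continuous n : continuous (cheb_primitive n).
Proof.
move=> u; apply: cvgM.
  apply: continuous_comp; last exact: sqrt_continuous.
  by apply: cvgB; [exact: cvg_cst|exact: exprn_continuous].
by apply: cvgB; (apply: cvgM; [exact: qherm_continuous|exact: cvg_cst]).
Qed.

End ChebyshevIntegral.

Section Interval.
Context {R : realType}.
Variable q : R.
Hypothesis q1 : `|q| < 1.
Implicit Types (x : R) (n : nat).

Definition scaled x := Num.sqrt (1 - q) * x.
Definition semicircle x := Num.sqrt (4 - (1 - q) * x ^+ 2).

Lemma oneBq_gt0 : 0 < 1 - q.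
Proof. by rewrite subr_gt0 (le_lt_trans (ler_norm _)). Qed.

Lemma sqrtq_gt0 : 0 < Num.sqrt (1 - q).
Proof. by rewrite sqrtr_gt0 oneBq_gt0. Qed.

Lemma scaled_sqr x : scaled x ^+ 2 = (1 - q) * x ^+ 2.
Proof. by rewrite /scaled exprMn sqr_sqrtr// ltW// oneBq_gt0. Qed.

Lemma semicircleE x : semicircle x = Num.sqrt (4 - scaled x ^+ 2).
Proof. by rewrite scaled_sqr. Qed.

Lemma SqP x : Sq q x <-> `|scaled x| <= 2.
Proof.
rewrite /Sq /= in_itv/= -ler_norml ler_pdivlMr ?sqrtq_gt0//.
by rewrite /scaled normrM (gtr0_norm sqrtq_gt0) mulrC.
Qed.

Lemma measurable_Sq : measurable (Sq q).
Proof. exact: measurable_itv. Qed.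

Lemma compact_Sq : compact (Sq q).
Proof. exact: segment_compact. Qed.

Lemma leb_Sq_fin : (@lebesgue_measure R (Sq q) < +oo)%E.
Proof. exact/compact_finite_measure/compact_Sq. Qed.

Lemma bddmeas_continuous (F : R -> R) : continuous F -> bddmeas (Sq q : set (measurableTypeR R)) F.
Proof.
move=> cF; split; first by apply: measurable_funTS; exact: continuous_measurable_fun.
have := compact_bounded (continuous_compact (continuous_subspaceT cF) compact_Sq).
move=> [M [Mr MF]]; exists (M + 1) => x Sx.
by apply: (MF (M + 1)); [rewrite ltrDl|exists x].
Qed.

Lemma scaled_continuous : continuous scaled.
Proof. by move=> x; apply: cvgM; [exact: cvg_cst|exact: cvg_id]. Qed.

Lemma semicircle_continuous : continuous semicircle.
Proof.
move=> x; apply: continuous_comp; last exact: sqrt_continuous.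
apply: cvgB; first exact: cvg_cst.
by apply: cvgM; [exact: cvg_cst|exact: exprn_continuous].
Qed.

Lemma qherm_scaled_continuous (p : R) n : continuous (fun x => qherm p (scaled x) n).
Proof.
move=> x; apply: (@continuous_comp _ _ _ scaled (fun u => qherm p u n)).
  exact: scaled_continuous.
exact: qherm_continuous.
Qed.

(** The antiderivative [cheb_primitive] vanishes at both ends of S(q). *)
Lemma cheb_integral n :
  \int[lebesgue_measure]_(x in Sq q) (cheb (scaled x) n.+1 * semicircle x) = 0.
Proof.
set s := Num.sqrt (1 - q); have s0 : 0 < s by exact: sqrtq_gt0.
pose F x := cheb_primitive n (scaled x) / s.
have cF : continuous F.
  move=> x; apply: cvgM; last exact: cvg_cst.
  by apply: (@continuous_comp _ _ _ scaled (cheb_primitive n));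
    [exact: scaled_continuous|exact: cheb_primitive_continuous].
have dF : {in `]- (2 / s), 2 / s[, forall x,
    is_derive x 1 F (cheb (scaled x) n.+1 * semicircle x)}.
  move=> x; rewrite in_itv/= -ltr_norml ltr_pdivlMr// => xs.
  have sx2 : 0 < 4 - scaled x ^+ 2.
    have : `|scaled x| < 2 by rewrite /scaled normrM (gtr0_norm s0) mulrC.
    by rewrite -[scaled x ^+ 2]real_normK ?num_real// => ?; have := normr_ge0 (scaled x); nra.
  have d1 := is_derive_cheb_primitive n sx2.
  have d2 : is_derive x 1 scaled s.
    rewrite (_ : scaled = s \*: id); last by apply/funext.
    by apply: is_derive_eq; rewrite /GRing.scale/= mulr1.
  have d := is_derive1_comp d1 d2.
  rewrite (_ : F = s^-1 \*: (cheb_primitive n \o scaled)); last first.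
    by apply/funext => y; rewrite /F /= mulrC.
  by apply: is_derive_eq; rewrite /GRing.scale/= -semicircleE; field; rewrite gt_eqF.
have ab : - (2 / s) < 2 / s by rewrite gtrN// divr_gt0.
rewrite /Rintegral /Sq -/s (@continuous_FTC2 _ _ F)//.
(* The square root vanishes at the end points. *)
- have F0 x : `|scaled x| = 2 -> F x = 0.
    move=> e; rewrite /F /cheb_primitive -[scaled x ^+ 2]real_normK ?num_real// e.
    by rewrite (_ : 4 - 2 ^+ 2 = 0) ?sqrtr0 ?mul0r//; ring.
  rewrite !F0 ?subee//; rewrite /scaled -/s.
    by rewrite mulrN normrN mulrC divfK ?gt_eqF// gtr0_norm.
  by rewrite mulrC divfK ?gt_eqF// gtr0_norm.
- apply: continuous_subspaceT => x.
  by apply: cvgM; [exact: qherm_scaled_continuous|exact: semicircle_continuous].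
- split; first by move=> x /dF d; apply: ex_derive.
    exact: cvg_at_right_filter (cF _).
  exact: cvg_at_left_filter (cF _).
- by move=> x /dF d; rewrite derive1E; exact: derive_val.
Qed.

End Interval.

(** * Coefficients of the truncated Jacobi triple product *)

Section TripleProductCoefficients.
Context {R : realType}.
Variable q : R.
Hypothesis q1 : `|q| < 1.
Implicit Types (N k : nat).
Local Notation qfact := (qfact q).

(** The coefficients of the finite Jacobi triple product, that is
    (-1)^k q^(k(k+1)/2) times the q-binomial of 2N+1 over N-k: the product of
    the l_q(x | q^i) for 1 <= i <= N is the sum over k <= N of
    [theta_coef] N k times the Chebyshev polynomial of index 2 k. *)
Definition theta_coef N k : R :=
  if (k <= N)%N then
    (-1) ^+ k * q ^+ 'C(k.+1, 2) * (qfact N.*2.+1 / (qfact (N - k) * qfact (N + k).+1))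
  else 0.

Lemma qfact_neq0 n : qfact n != 0. Proof. by rewrite gt_eqF// qfact_gt0. Qed.

Lemma theta_coef00 k : theta_coef 0 k = (k == 0%N)%:R.
Proof.
by case: k => [|k]//; rewrite /theta_coef /= !expr0 !mul1r /qfact big_ord0 mul1r divff// qfact_neq0.
Qed.

Lemma binSS2 k : 'C(k.+2, 2) = ('C(k.+1, 2) + k.+1)%N.
Proof. by rewrite binS bin1. Qed.

Lemma theta_coefS0 N : theta_coef N.+1 0 =
  (1 + q ^+ N.+1 + q ^+ N.+1 ^+ 2) * theta_coef N 0 - q ^+ N.+1 * theta_coef N 1.
Proof.
have -> : theta_coef N 1 = - q * qfact N.*2.+1 / (qfact N.+1 * qfact N.+2) * (1 - q ^+ N) * (1 - q ^+ N.+1).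
  case: N => [|N]; first by rewrite /theta_coef/= expr0; ring.
  rewrite /theta_coef /= subn1 addn1 !qfactS /= expr1; field.
  by rewrite !qfact_neq0 !gt_eqF// onesubX_gt0.
rewrite /theta_coef /= !subn0 !addn0 !expr0 !mul1r doubleS !qfactS.
have -> : q ^+ N.*2.+2 = q ^+ N.+1 * q ^+ N.+1 by rewrite -exprD; congr (_ ^+ _); lia.
have -> : q ^+ N.*2.+3 = q * (q ^+ N.+1 * q ^+ N.+1).
  by rewrite -exprD -exprS; congr (_ ^+ _); lia.
have x1 : 1 - q ^+ N.+1 != 0 by rewrite gt_eqF// onesubX_gt0.
have x2 : 1 - q ^+ N.+2 != 0 by rewrite gt_eqF// onesubX_gt0.
move: x1 x2; rewrite !(exprS q); set z := q ^+ N => x1 x2.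
by field; rewrite !qfact_neq0 x1 x2.
Qed.

(** After division by a common factor T all four coefficients are polynomials
    in q, q^k and q^(N-k), and the recurrence becomes an identity between them. *)
Lemma theta_coefSS N k : theta_coef N.+1 k.+1 =
  (1 + q ^+ N.+1 ^+ 2) * theta_coef N k.+1 - q ^+ N.+1 * (theta_coef N k.+2 + theta_coef N k).
Proof.
have [kN|Nk] := leqP k N; last first.
  (* All four coefficients vanish for k > N. *)
  have [n0 n1 n2 n3] : [/\ (k <= N)%N = false, (k.+1 <= N)%N = false,
      (k.+2 <= N)%N = false & (k.+1 <= N.+1)%N = false] by split; lia.
  by rewrite /theta_coef n0 n1 n2 n3 addr0 !mulr0 subr0.
(* The forms below remain valid for k = N and k = N - 1, where the factors
     1 - q^(N-k) or q - q^(N-k) replace the convention that coefficients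
     beyond N are 0. *)
pose T := (-1) ^+ k * q ^+ 'C(k.+1, 2) * (qfact N.*2.+1 / (qfact (N - k) * qfact (N + k).+3)).
have e0 : theta_coef N k = T * (1 - q ^+ (N + k).+2) * (1 - q ^+ (N + k).+3).
  rewrite /theta_coef kN /T !qfactS; field.
  by rewrite !qfact_neq0 !gt_eqF// onesubX_gt0.
have e1 : theta_coef N k.+1 = - q ^+ k.+1 * T * (1 - q ^+ (N - k)) * (1 - q ^+ (N + k).+3).
  rewrite /theta_coef; case: ltnP => [kN'|Nk]; last first.
    by rewrite (_ : (N - k = 0)%N); [rewrite expr0; ring|lia].
  rewrite /T (_ : (N - k = (N - k.+1).+1)%N); last lia.
  rewrite addnS binSS2 exprD !qfactS (exprS (-1)); field.
  by rewrite !qfact_neq0 !gt_eqF// onesubX_gt0.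
have e2 : theta_coef N k.+2 = q ^+ k.+1 ^+ 2 * T * (1 - q ^+ (N - k)) * (q - q ^+ (N - k)).
  rewrite /theta_coef; case: ltnP => [kN'|Nk]; last first.
    have [->|->] : (N - k = 0)%N \/ (N - k = 1)%N by lia.
      by rewrite expr0; ring.
    by rewrite expr1; ring.
  rewrite /T (_ : (N - k = (N - k.+2).+2)%N); last lia.
  rewrite !addnS !binSS2 !exprD !qfactS !(exprS (-1)) !(exprS q); field.
  by rewrite -!(exprS q) !qfact_neq0 !gt_eqF// onesubX_gt0.
have e3 : theta_coef N.+1 k.+1 = - q ^+ k.+1 * T * (1 - q ^+ N.*2.+2) * (1 - q ^+ N.*2.+3).
  rewrite /theta_coef ltnS kN /T subSS addSn addnS doubleS binSS2 exprD !qfactS (exprS (-1)); field.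
  by rewrite !qfact_neq0 !gt_eqF// onesubX_gt0.
rewrite e0 e1 e2 e3; move: T {e0 e1 e2 e3} => T.
have -> : N = (k + (N - k))%N by lia.
move: (N - k)%N => d; rewrite addKn -!muln2 mulnDl !(exprS q) !(exprD q) !exprM.
by rewrite !expr2; ring.
Qed.

Lemma qfact_cvg : qfact @ \oo --> qpoch q q.
Proof.
rewrite (_ : qfact = fun n => \prod_(k < n) (1 - q * q ^+ k)); first exact: qpoch_cvg.
by apply/funext => n; apply: eq_bigr => k _; rewrite -exprS.
Qed.

Lemma theta_coef_cvg k :
  (fun N => theta_coef N k) @ \oo --> (-1) ^+ k * q ^+ 'C(k.+1, 2) / qpoch q q.
Proof.
have Q0 : qpoch q q != 0 by rewrite gt_eqF// qpoch_gt0.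
rewrite -(cvg_shiftn k).
have c (g : nat -> nat) : g @ \oo --> \oo -> (fun N => qfact (g N)) @ \oo --> qpoch q q.
  by move=> cg; apply: cvg_comp qfact_cvg.
rewrite (_ : [sequence _]_n = fun N => (-1) ^+ k * q ^+ 'C(k.+1, 2) *
   (qfact ((N * 2) + (k * 2).+1) / (qfact N * qfact (N + (k * 2).+1)))); last first.
  apply/funext => N /=; rewrite /theta_coef leq_addl addnK.
  by congr (_ * (qfact _ / (_ * qfact _))); lia.
rewrite (_ : _ / qpoch q q = (-1) ^+ k * q ^+ 'C(k.+1, 2) *
    (qpoch q q / (qpoch q q * qpoch q q))); last by field.
apply: cvgM; first exact: cvg_cst.
apply: cvgM.
  apply: c; apply: (@cvg_comp _ _ _ (muln^~ 2%N) (addn^~ (k * 2).+1)).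
    exact: cvg_mulnr.
  exact: cvg_addnr.
apply: cvgV; first by rewrite mulf_neq0.
by apply: cvgM; [exact: qfact_cvg|apply: c; exact: cvg_addnr].
Qed.

End TripleProductCoefficients.

(** * Orthogonality of the q-Hermite polynomials *)

Section Orthogonality.
Context {R : realType}.
Variable q : R.
Hypothesis q1 : `|q| < 1.
Implicit Types (x u a : R) (n m k N : nat).
Local Notation S := (Sq q : set (measurableTypeR R)).
Local Notation scaled := (scaled q).
Local Notation leb := (@lebesgue_measure R).
Local Notation mS := (measurable_Sq q).
Local Notation fS := (leb_Sq_fin q).

Definition trunc_weight N x := semicircle q x * \prod_(i < N) lq q x (q ^+ i.+1).
Definition limit_weight x := semicircle q x * infprod (fun i => lq q x (q ^+ i.+1)).

Lemma lqE x a : lq q x a = (1 + a) ^+ 2 - a * scaled x ^+ 2.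
Proof. by rewrite /lq scaled_sqr//; ring. Qed.

(** The three-term rule u^2 U_(m+2) = U_(m+4) + 2 U_(m+2) + U_m.  The indices 0
    and 1 obey variants of it, treated in [trunc_moment_S0] and
    [trunc_moment_S1]. *)
Lemma cheb_lq x a m : lq q x a * cheb (scaled x) m.+2 =
  (1 + a ^+ 2) * cheb (scaled x) m.+2 - a * cheb (scaled x) m.+4 - a * cheb (scaled x) m.
Proof. by rewrite lqE !chebSS; ring. Qed.

Lemma lq_factor x i : Sq q x -> `|lq q x (q ^+ i.+1) - 1| <= 7 * `|q| ^+ i.
Proof.
move=> /(SqP q1) x2; set a := q ^+ i.+1.
have a1 : `|a| <= `|q| ^+ i.
  by rewrite normrX exprS ler_piMl// ?exprn_ge0// ltW.
have a2 : `|a| <= 1 by rewrite normrX exprn_ile1// ltW.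
have -> : lq q x a - 1 = a * (2 + a - scaled x ^+ 2) by rewrite lqE; ring.
rewrite normrM mulrC; apply: ler_pM => //.
have : scaled x ^+ 2 <= 4 by rewrite -real_normK ?num_real//; have := normr_ge0 (scaled x); nra.
have := sqr_ge0 (scaled x); move: a2; rewrite !ler_norml => /andP[? ?] ? ?.
by apply/andP; split; lra.
Qed.

Lemma bddmeas_lq a : bddmeas S (fun x => lq q x a).
Proof.
apply: bddmeas_continuous => x; apply: cvgB; first exact: cvg_cst.
by apply: cvgM; [exact: cvg_cst|exact: exprn_continuous].
Qed.

Lemma bddmeas_semicircle : bddmeas S (semicircle q).
Proof. exact/bddmeas_continuous/semicircle_continuous. Qed.

Lemma bddmeas_qherm (p : R) n : bddmeas S (fun x => qherm p (scaled x) n).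
Proof. exact/bddmeas_continuous/qherm_scaled_continuous. Qed.

Lemma bddmeas_trunc_weight N : bddmeas S (trunc_weight N).
Proof. by apply: bddmeasM; [exact: bddmeas_semicircle|apply: bddmeas_prod => i; exact: bddmeas_lq]. Qed.

Lemma trunc_weight_unif : exists e : nat -> R, e @ \oo --> (0 : R) /\
  forall N x, Sq q x -> `|limit_weight x - trunc_weight N x| <= e N.
Proof.
have [_ [M wM]] := bddmeas_semicircle.
have [K [s [K0 s0 s1 vK]]] := @partial_prod_increments R q 7 q1 (ler0n _ _).
exists (fun N => M * (K / (1 - s)) * s ^+ N); split.
  by apply: cvg_geometric0; rewrite gtr0_norm.
move=> N x Sx; rewrite /limit_weight /trunc_weight -mulrBr normrM -mulrA.
have [_ tail] := geometric_increments K0 (ltW s0) s1 (vK _ (fun i => lq_factor i Sx)).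
by apply: ler_pM => //; exact: wM.
Qed.

Lemma bddmeas_limit_weight : bddmeas S limit_weight.
Proof. by have [e [e0 We]] := trunc_weight_unif; apply: bddmeas_unif bddmeas_trunc_weight _ e0. Qed.

Lemma integral_trunc_weight_cvg F : bddmeas S F ->
  (fun N => \int[leb]_(x in S) (F x * trunc_weight N x)) @ \oo --> \int[leb]_(x in S) (F x * limit_weight x).
Proof.
move=> bF; have [e [e0 We]] := trunc_weight_unif; have [_ [M FM]] := bF.
apply: (@Rint_unif _ _ _ leb _ mS fS _ _ (fun N => M * e N)).
- by move=> N; apply: bddmeasM => //; exact: bddmeas_trunc_weight.
- move=> N x Sx; rewrite -mulrBr normrM; apply: ler_pM => //; first exact: FM.
  exact: We.
- by rewrite -[X in _ --> X](mulr0 M); apply: cvgM => //; exact: cvg_cst.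
Qed.

Definition trunc_moment N m := \int[leb]_(x in S) (cheb (scaled x) m * trunc_weight N x).

Lemma bddmeas_cheb_trunc_weight N m : bddmeas S (fun x => cheb (scaled x) m * trunc_weight N x).
Proof. by apply: bddmeasM; [exact: bddmeas_qherm|exact: bddmeas_trunc_weight]. Qed.

Lemma integral_lin3 (c1 c2 c3 : R) (F1 F2 F3 : R -> R) :
  bddmeas S F1 -> bddmeas S F2 -> bddmeas S F3 ->
  \int[leb]_(x in S) (c1 * F1 x + (c2 * F2 x + c3 * F3 x)) =
  c1 * \int[leb]_(x in S) F1 x + (c2 * \int[leb]_(x in S) F2 x +
   c3 * \int[leb]_(x in S) F3 x).
Proof.
move=> b1 b2 b3; have b3' := bddmeasZ c3 b3.
rewrite (@Rint_lin _ _ _ leb _ mS fS)//; last by apply: bddmeasD => //; exact: bddmeasZ.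
rewrite (@Rint_lin _ _ _ leb _ mS fS)// RintegralZl//; first exact: mS.
exact: (@bddmeas_integrable _ _ _ leb _ mS fS).
Qed.

Lemma trunc_moment_SS N m : trunc_moment N.+1 m.+2 =
  (1 + q ^+ N.+1 ^+ 2) * trunc_moment N m.+2 - q ^+ N.+1 * (trunc_moment N m.+4 + trunc_moment N m).
Proof.
transitivity ((1 + q ^+ N.+1 ^+ 2) * trunc_moment N m.+2 + ((- q ^+ N.+1) * trunc_moment N m.+4
   + (- q ^+ N.+1) * trunc_moment N m)); last by ring.
rewrite /trunc_moment -integral_lin3; [|exact: bddmeas_cheb_trunc_weight..].
apply: eq_Rintegral => x _; rewrite /trunc_weight big_ord_recr/=.
set P := \prod_(i < N) _.
transitivity (lq q x (q ^+ N.+1) * cheb (scaled x) m.+2 * (semicircle q x * P)); first by ring.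
by rewrite cheb_lq; ring.
Qed.

Lemma trunc_moment_S0 N : trunc_moment N.+1 0 =
  (1 + q ^+ N.+1 + q ^+ N.+1 ^+ 2) * trunc_moment N 0 - q ^+ N.+1 * trunc_moment N 2.
Proof.
transitivity ((1 + q ^+ N.+1 + q ^+ N.+1 ^+ 2) * trunc_moment N 0 + ((- q ^+ N.+1) * trunc_moment N 2
   + 0 * trunc_moment N 0)); last by ring.
rewrite /trunc_moment -integral_lin3; [|exact: bddmeas_cheb_trunc_weight..].
apply: eq_Rintegral => x _; rewrite /trunc_weight big_ord_recr/= chebSS cheb1 cheb0 lqE; ring.
Qed.

Lemma trunc_moment_S1 N : trunc_moment N.+1 1 =
  (1 + q ^+ N.+1 ^+ 2) * trunc_moment N 1 - q ^+ N.+1 * trunc_moment N 3.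
Proof.
transitivity ((1 + q ^+ N.+1 ^+ 2) * trunc_moment N 1 + ((- q ^+ N.+1) * trunc_moment N 3
   + 0 * trunc_moment N 1)); last by ring.
rewrite /trunc_moment -integral_lin3; [|exact: bddmeas_cheb_trunc_weight..].
apply: eq_Rintegral => x _; rewrite /trunc_weight big_ord_recr/= !chebSS cheb1 cheb0 lqE; ring.
Qed.

Lemma trunc_moment0S m : trunc_moment 0 m.+1 = 0.
Proof.
rewrite -(cheb_integral q1 m); apply: eq_Rintegral => x _.
by rewrite /trunc_weight big_ord0 mulr1.
Qed.

Lemma trunc_moment_odd N k : trunc_moment N k.*2.+1 = 0.
Proof.
elim: N k => [|N IH] [|k]; rewrite ?trunc_moment0S//.
  by rewrite trunc_moment_S1 (IH 0%N) (IH 1%N) !mulr0 subr0.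
by rewrite doubleS trunc_moment_SS -!doubleS !IH addr0 !mulr0 subr0.
Qed.

(** Both sides obey the same recurrence in N, with the same initial values by
    [cheb_integral]. *)
Lemma trunc_moment_even N k : trunc_moment N k.*2 = trunc_moment 0 0 * theta_coef q N k.
Proof.
elim: N k => [|N IH] [|k].
- by rewrite theta_coef00// mulr1.
- by rewrite theta_coef00// mulr0 doubleS trunc_moment0S.
- by rewrite trunc_moment_S0 (IH 0%N) (IH 1%N) theta_coefS0//; ring.
- by rewrite doubleS trunc_moment_SS -!doubleS !IH theta_coefSS//; ring.
Qed.

Lemma integral_cheb_fN m F : bddmeas S F ->
  \int[leb]_(x in S) (F x * fN q x) =
  qpoch q q * Num.sqrt (1 - q) / (2 * pi) * \int[leb]_(x in S) (F x * limit_weight x).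
Proof.
move=> bF; rewrite -RintegralZl; first last.
- by apply: (@bddmeas_integrable _ _ _ leb _ mS fS); apply: bddmeasM => //; exact: bddmeas_limit_weight.
- exact: mS.
by apply: eq_Rintegral => x _; rewrite /fN /limit_weight /semicircle; ring.
Qed.

Lemma bddmeas_fN : bddmeas S (fN q).
Proof.
apply: (@bddmeas_ext _ _ _ _ _ (fun x =>
    (qpoch q q * Num.sqrt (1 - q) / (2 * pi)) * limit_weight x)).
  by move=> x _; rewrite /fN /limit_weight /semicircle; ring.
by apply: bddmeasZ; exact: bddmeas_limit_weight.
Qed.

(** The constant c absorbs the normalization of fN, which cancels in the end. *)
Lemma cheb_moments_fN : exists c : R, forall k,
  \int[leb]_(x in S) (cheb (scaled x) k.*2 * fN q x) = c * ((-1) ^+ k * q ^+ 'C(k.+1, 2)) /\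
  \int[leb]_(x in S) (cheb (scaled x) k.*2.+1 * fN q x) = 0.
Proof.
exists (qpoch q q * Num.sqrt (1 - q) / (2 * pi) * (trunc_moment 0 0 / qpoch q q)) => k.
have even : \int[leb]_(x in S) (cheb (scaled x) k.*2 * limit_weight x) =
    trunc_moment 0 0 * ((-1) ^+ k * q ^+ 'C(k.+1, 2) / qpoch q q).
  apply: (limn_eq (fun N => trunc_moment_even N k)).
    by apply: integral_trunc_weight_cvg; exact: bddmeas_qherm.
  by apply: cvgM; [exact: cvg_cst|exact: theta_coef_cvg].
have odd : \int[leb]_(x in S) (cheb (scaled x) k.*2.+1 * limit_weight x) = 0.
  apply: (limn_eq (fun N => trunc_moment_odd N k)); last exact: cvg_cst.
  by apply: integral_trunc_weight_cvg; exact: bddmeas_qherm.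
split; rewrite integral_cheb_fN ?even ?odd ?mulr0//; try exact: bddmeas_qherm.
by ring.
Qed.

Definition qherm_cheb n m := \int[leb]_(x in S) (qherm q (scaled x) n * cheb (scaled x) m * fN q x).
Definition qherm_gram n m := \int[leb]_(x in S) (qherm q (scaled x) n * qherm q (scaled x) m * fN q x).

Lemma bddmeas_prod3 (p : R) n m : bddmeas S (fun x => qherm q (scaled x) n * qherm p (scaled x) m * fN q x).
Proof. by apply: bddmeasM; [apply: bddmeasM; exact: bddmeas_qherm|exact: bddmeas_fN]. Qed.

Lemma qherm_cheb_SS n m : qherm_cheb n.+1 m.+1 =
  qherm_cheb n m.+2 + qherm_cheb n m - (1 - q ^+ n) * qherm_cheb n.-1 m.+1.
Proof.
transitivity (1 * qherm_cheb n m.+2 + (1 * qherm_cheb n m + (- (1 - q ^+ n)) * qherm_cheb n.-1 m.+1));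
  last by ring.
rewrite /qherm_cheb -integral_lin3; [|exact: bddmeas_prod3..].
apply: eq_Rintegral => x _; rewrite qhermS chebSS; ring.
Qed.

Lemma qherm_cheb_S0 n : qherm_cheb n.+1 0 = qherm_cheb n 1 - (1 - q ^+ n) * qherm_cheb n.-1 0.
Proof.
transitivity (1 * qherm_cheb n 1 + ((- (1 - q ^+ n)) * qherm_cheb n.-1 0 + 0 * qherm_cheb n 0));
  last by ring.
rewrite /qherm_cheb -integral_lin3; [|exact: bddmeas_prod3..].
apply: eq_Rintegral => x _; rewrite qhermS cheb1 cheb0; ring.
Qed.

(** Multiplication by u is symmetric for the inner product defined by fN. *)
Lemma qherm_gram_S n m : qherm_gram n m.+1 =
  qherm_gram n.+1 m + (1 - q ^+ n) * qherm_gram n.-1 m - (1 - q ^+ m) * qherm_gram n m.-1.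
Proof.
transitivity (1 * qherm_gram n.+1 m + ((1 - q ^+ n) * qherm_gram n.-1 m + (- (1 - q ^+ m)) * qherm_gram n m.-1));
  last by ring.
rewrite /qherm_gram -integral_lin3; [|exact: bddmeas_prod3..].
apply: eq_Rintegral => x _; rewrite !qhermS; ring.
Qed.

(** Induction on n with [qherm_cheb_SS], starting from the Chebyshev moments at
    n = 0.  In the step to n + 1 the only nonzero integrals that contribute
    below the diagonal are those of h_n U_n and h_(n-1) U_(n-1); they cancel
    since (q)_n = (1 - q^n) (q)_(n-1). *)
Lemma qherm_cheb_eval (c : R) :
  (forall k, qherm_cheb 0 k.*2 = c * ((-1) ^+ k * q ^+ 'C(k.+1, 2)) /\ qherm_cheb 0 k.*2.+1 = 0) ->
  forall n, [/\ forall k, qherm_cheb n (n + k.*2) =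
                c * ((-1) ^+ k * q ^+ 'C(k.+1, 2) * qfact q (n + k) / qfact q k),
              forall k, qherm_cheb n (n + k.*2.+1) = 0 &
              forall m, (m < n)%N -> qherm_cheb n m = 0].
Proof.
move=> H0 n; have [N] := ubnP n; elim: N n => // N IH [_|n nN].
  split=> // k; rewrite add0n; last by case: (H0 k).
  by case: (H0 k) => -> _; rewrite mulfK// qfact_neq0.
have [A B C] := IH n nN; have [A' B' C'] : [/\ forall k, (0 < n)%N -> qherm_cheb n.-1 (n + k.*2.+1) =
      c * ((-1) ^+ k.+1 * q ^+ 'C(k.+2, 2) * qfact q (n + k) / qfact q k.+1),
      forall k, (0 < n)%N -> qherm_cheb n.-1 (n + k.*2) = 0 &
      forall m, (m.+1 < n)%N -> qherm_cheb n.-1 m = 0].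
  case: n nN {A B C} => [|n] nN; first by split.
  have [A B C] := IH n (ltnW nN); split=> [k _|k _|m mn] /=.
  - by have := A k.+1; rewrite doubleS !addnS !addSn.
  - by have := B k; rewrite addSn addnS.
  - exact: C.
(* For n = 0 the index n.-1 is meaningless, but its coefficient is 0. *)
have coef0 : n = 0%N -> 1 - q ^+ n = 0 by move=> ->; rewrite expr0 subrr.
split.
- move=> k; rewrite addSn qherm_cheb_SS.
  have -> : (n + k.*2).+2 = (n + k.+1.*2)%N by rewrite doubleS !addnS.
  rewrite !A.
  have -> : (1 - q ^+ n) * qherm_cheb n.-1 (n + k.*2).+1 = (1 - q ^+ n) *
     (c * ((-1) ^+ k.+1 * q ^+ 'C(k.+2, 2) * qfact q (n + k) / qfact q k.+1)).
    case: (posnP n) => [/coef0 ->|n0]; first by rewrite !mul0r.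
    by rewrite -A'// addnS.
  rewrite !addnS addSn !qfactS binSS2 (exprD q) (exprS (-1)) !(exprS q) exprD.
  have x1 : 1 - q * q ^+ k != 0 by rewrite -exprS gt_eqF// onesubX_gt0.
  by field; rewrite x1 qfact_neq0.
- move=> k; rewrite addSn qherm_cheb_SS.
  have -> : (n + k.*2.+1).+2 = (n + k.+1.*2.+1)%N by rewrite doubleS !addnS.
  rewrite !B add0r sub0r.
  case: (posnP n) => [/coef0 ->|n0]; first by rewrite mul0r oppr0.
  have -> : (n + k.*2.+1).+1 = (n + k.+1.*2)%N by rewrite doubleS !addnS.
  by rewrite B'// mulr0 oppr0.
- case=> [|m] mn.
    rewrite qherm_cheb_S0; case: n A B C A' B' C' {nN IH mn coef0} => [|[|n]] A B C A' B' C'.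
    + by rewrite expr0 subrr mul0r subr0; have := B 0%N.
    + have := A 0%N; rewrite add1n => ->.
      by have := H0 0%N => -[-> _]; rewrite /qfact !big_ord_recr !big_ord0/=; field; rewrite ?oner_eq0.
    + by rewrite C// C'// mulr0 subr0.
  rewrite qherm_cheb_SS (C m)//.
  have [m2n|nm2|nm2] := ltngtP m.+2 n.
  + by rewrite C// C'// mulr0 addr0 subr0.
  + have e : n = m.+1 by lia.
    rewrite -e addr0; have := B 0%N; rewrite double0 addn1 => ->.
    by have := B' 0%N; rewrite double0 addn0 => ->; rewrite ?e// mulr0 subr0.
  + have := A 0%N; rewrite double0 !addn0 -{2}nm2 => ->.
    have -> : qherm_cheb n.-1 m.+1 = c * qfact q m.+1.
      rewrite -nm2 /=; have [] := IH m.+1; first by lia.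
      move=> /(_ 0%N) + _ _; rewrite double0 !addn0 => ->.
      by rewrite /qfact big_ord0 !expr0; field; rewrite ?oner_eq0.
    by rewrite -nm2 qfactS /qfact big_ord0 !expr0; field; rewrite ?oner_eq0.
Qed.

(** Only the integrals of the single h_n are taken from [qherm_cheb_eval]; the
    symmetry [qherm_gram_S] propagates them to all products. *)
Lemma qherm_orthogonal : exists c : R, forall n m, qherm_gram n m = (n == m)%:R * (c * qfact q m).
Proof.
have [c cE] := cheb_moments_fN; exists c.
have H0 k : qherm_cheb 0 k.*2 = c * ((-1) ^+ k * q ^+ 'C(k.+1, 2)) /\ qherm_cheb 0 k.*2.+1 = 0.
  have hc0 m : qherm_cheb 0 m = \int[leb]_(x in S) (cheb (scaled x) m * fN q x).
    by apply: eq_Rintegral => x _; rewrite qherm0 mul1r.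
  by rewrite !hc0; exact: cE.
have h0 n : qherm_gram n 0 = (n == 0%N)%:R * c.
  have -> : qherm_gram n 0 = qherm_cheb n 0 by apply: eq_Rintegral => x _; rewrite qherm0 cheb0.
  have [A _ C] := qherm_cheb_eval H0 n; case: n A C => [|n] A C; last by rewrite mul0r C.
  have := A 0%N; rewrite double0 !addn0 => -> /=; rewrite /qfact big_ord0 !expr0; by field; rewrite ?oner_eq0.
have t1 : true%:R = 1 :> R by [].
have f0 : false%:R = 0 :> R by [].
move=> n m; have [N] := ubnP m; elim: N m n => // N IH [|m] n mN.
  by rewrite h0 /qfact big_ord0 mulr1.
rewrite qherm_gram_S (IH m n.+1)// (IH m n.-1)// (IH m.-1 n); last by lia.
have [->|nm1] := eqVneq n m.+1.
  have [e1 e2] : (m.+2 == m) = false /\ (m.+1 == m.-1) = false by split; lia.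
  by rewrite e1 e2 /= !eqxx qfactS t1; ring.
have [<-|nm2] := eqVneq n.+1 m.
  have [e1 e2] : (n.-1 == n.+1) = false /\ (n == n.+2) = false by split; lia.
  by rewrite e1 /= !eqxx qfactS t1; ring.
have [[-> ->]|nm0] : (n = 0%N /\ m = 0%N) \/ ~ (n = 0%N /\ m = 0%N) by lia.
  by rewrite !expr0 subrr !mul0r addr0 subr0.
have [e1 e2] : (n.-1 == m) = false /\ (n == m.-1) = false by split; lia.
by rewrite e1 e2 f0 !mul0r !mulr0 addr0 subr0.
Qed.

End Orthogonality.

(** * Composition of kernels *)

Section KernelComposition.
Context {R : realType}.
Variable q : R.
Hypothesis q1 : `|q| < 1.
Implicit Types (x y u v w a b : R) (n m i j k N : nat).
Local Notation S := (Sq q : set (measurableTypeR R)).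
Local Notation scaled := (scaled q).
Local Notation leb := (@lebesgue_measure R).
Local Notation mS := (measurable_Sq q).
Local Notation fS := (leb_Sq_fin q).
Local Notation carlitz := (carlitz q).
Local Notation mehler := (mehler q).

Lemma carlitz_bound a i j : `|a| < 1 ->
  exists M, forall u v, `|u| <= 2 -> `|v| <= 2 -> `|carlitz a i j u v| <= M.
Proof.
move=> a1; have [K [s [K0 s0 s1 H]]] := carlitz_unif q1 i j a1.
exists K => u v u2 v2; have [_ /(_ 0%N)] := H u v u2 v2.
by rewrite /series/= big_geq// subr0 expr0 mulr1.
Qed.

Section BoundedKernels.
Context d (T : measurableType d) (D : set T) (f : T -> R).
Hypothesis bf : bddmeas D f.

Lemma bddmeas_qherm_comp (p : R) n : bddmeas D (fun t => qherm p (f t) n).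
Proof.
have [m] := ubnP n; elim: m n => // m IH [_|n nm].
  by apply: (bddmeas_ext _ (bddmeas_cst D 1)).
apply: (@bddmeas_ext _ _ _ _ _ (fun t => f t * qherm p (f t) n - (1 - p ^+ n) * qherm p (f t) n.-1)).
  by move=> t _; rewrite qhermS.
by apply: bddmeasB; [apply: bddmeasM => //; exact: IH|apply: bddmeasZ; apply: IH; lia].
Qed.
End BoundedKernels.

Section BoundedKernels2.
Context d (T : measurableType d) (D : set T) (f g : T -> R).
Hypotheses (bf : bddmeas D f) (bg : bddmeas D g).

Lemma bddmeas_series a i j N : bddmeas D (fun t => series (carlitz_term q a i j (f t) (g t)) N).
Proof.
apply: bddmeas_sum => n; rewrite /carlitz_term; apply: bddmeasZ.
by apply: bddmeasM; exact: bddmeas_qherm_comp.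
Qed.

Lemma bddmeas_carlitz a i j : `|a| < 1 -> (forall t, D t -> `|f t| <= 2) ->
  (forall t, D t -> `|g t| <= 2) -> bddmeas D (fun t => carlitz a i j (f t) (g t)).
Proof.
move=> a1 f2 g2; have [K [s [K0 s0 s1 H]]] := carlitz_unif q1 i j a1.
apply: (bddmeas_unif (bddmeas_series a i j)).
  by move=> n t Dx; have [_] := H _ _ (f2 t Dx) (g2 t Dx); apply.
by apply: cvg_geometric0; rewrite gtr0_norm.
Qed.
End BoundedKernels2.

Lemma scaled_le2 x : Sq q x -> `|scaled x| <= 2. Proof. by move=> /(SqP q1). Qed.

Lemma bddmeas_scaled : bddmeas S scaled.
Proof. exact/bddmeas_continuous/scaled_continuous. Qed.

Lemma bddmeas_carlitz_slice a i j v : `|a| < 1 -> `|v| <= 2 ->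
  bddmeas S (fun x => carlitz a i j (scaled x) v).
Proof.
move=> a1 v2; apply: bddmeas_carlitz => //; [exact: bddmeas_scaled|exact: bddmeas_cst|].
by move=> x /scaled_le2.
Qed.

(** The second sum is taken up to N + i, so that each h_(n+i) of the first one
    meets exactly one matching term. *)
Lemma integral_carlitz_partial c :
  (forall n m, qherm_gram q n m = (n == m)%:R * (c * qfact q m)) ->
  forall a b i j v w N,
  \int[leb]_(x in S) (series (carlitz_term q a i j (scaled x) v) N *
     series (carlitz_term q b 0 0 (scaled x) w) (N + i) * fN q x) =
  c * b ^+ i * series (carlitz_term q (a * b) j i v w) N.
Proof.
move=> orth a b i j v w N.
have bd n m : bddmeas S (fun x => qherm q (scaled x) n * qherm q (scaled x) m * fN q x) by exact: bddmeas_prod3.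
transitivity (\int[leb]_(x in S) (\sum_(0 <= n < N) (a ^+ n / qfact q n * qherm q v (n + j)) *
   (\sum_(0 <= m < N + i) (b ^+ m / qfact q m * qherm q w m) *
      (qherm q (scaled x) (n + i) * qherm q (scaled x) m * fN q x)))).
  apply: eq_Rintegral => x _; rewrite /series/= -mulrA mulr_suml; apply: eq_bigr => n _.
  rewrite mulr_suml !mulr_sumr; apply: eq_bigr => m _.
  by rewrite /carlitz_term !addn0; ring.
rewrite (@Rint_sum _ _ _ leb _ mS fS); last first.
  by move=> n; apply: bddmeas_sum => m; apply: bddmeasZ.
rewrite /series/= mulr_sumr; apply: eq_big_nat => n /andP[_ nN].
rewrite (@Rint_sum _ _ _ leb _ mS fS)//.
rewrite (eq_bigr (fun m => (b ^+ m / qfact q m * qherm q w m) * ((n + i == m)%:R * (c * qfact q m)))); last first.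
  by move=> m _; rewrite -orth.
rewrite (bigD1_seq (n + i)%N)/= ?iota_uniq ?mem_index_iota ?ltn_add2r//.
rewrite big1 ?addr0 ?eqxx; last by move=> m /negPf; rewrite eq_sym => ->; rewrite !(mul0r, mulr0).
rewrite /carlitz_term exprMn exprD mul1r; field.
by rewrite !qfact_neq0.
Qed.

(** Composition of kernels: orthogonality keeps the terms h_(n+i)(u) on both
    sides, which leaves the powers a^n b^(n+i) and exchanges the two shifts. *)
Lemma integral_carlitz c :
  (forall n m, qherm_gram q n m = (n == m)%:R * (c * qfact q m)) ->
  forall a b i j v w, `|a| < 1 -> `|b| < 1 -> `|v| <= 2 -> `|w| <= 2 ->
  \int[leb]_(x in S) (carlitz a i j (scaled x) v * mehler b (scaled x) w * fN q x) =
  c * b ^+ i * carlitz (a * b) j i v w.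
Proof.
move=> orth a b i j v w a1 b1 v2 w2.
have ab1 : `|a * b| < 1 by rewrite normrM mulr_ilt1.
have [K [s [K0 s0 s1 HA]]] := carlitz_unif q1 i j a1.
have [K' [s' [K0' s0' s1' HB]]] := carlitz_unif q1 0 0 b1.
have [M HM] := carlitz_bound i j a1; have [M' HM'] := carlitz_bound 0 0 b1.
have [_ [Mf Hf]] := bddmeas_fN q1.
have M'0 : 0 <= M' by apply: le_trans (HM' 0 0 _ _); rewrite ?normr0.
have Ms0 : `|s| < 1 by rewrite gtr0_norm.
have Ms0' : `|s'| < 1 by rewrite gtr0_norm.
apply: (limn_eq (fun N => integral_carlitz_partial orth a b i j v w N)); last first.
  by apply: cvgM; [exact: cvg_cst|exact: carlitz_cvg].
pose e N := K * s ^+ N; pose e' N := K' * s' ^+ (N + i).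
have ce : e @ \oo --> (0 : R) by exact: cvg_geometric0.
have ce' : e' @ \oo --> (0 : R).
  by have := cvg_geometric0 K' Ms0'; rewrite -(cvg_shiftn i).
apply: (@Rint_unif _ _ _ leb _ mS fS _ _ (fun N => (M * e' N + e N * (M' + e' N)) * Mf)).
- move=> N; apply: bddmeasM; last exact: bddmeas_fN.
  by apply: bddmeasM; apply: bddmeas_series; [exact: bddmeas_scaled|exact: bddmeas_cst|exact: bddmeas_scaled|exact: bddmeas_cst].
- move=> N x /[dup] Sx /scaled_le2 x2; rewrite -mulrBl normrM.
  apply: ler_pM => //; last exact: Hf.
  have [_ /(_ N) hA] := HA _ _ x2 v2; have [_ /(_ (N + i)%N) hB] := HB _ _ x2 w2.
  move: hA hB (HM _ _ x2 v2) (HM' _ _ x2 w2); rewrite -/(e N) -/(e' N) -/(mehler b (scaled x) w).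
  set F := carlitz _ _ _ _ _; set G := mehler _ _ _; set F_ := series _ N; set G_ := series _ (N + i).
  move=> hA hB hF hG.
  have -> : F * G - F_ * G_ = F * (G - G_) + (F - F_) * G_ by ring.
  apply: le_trans (ler_normD _ _) _; rewrite !normrM.
  apply: lerD; apply: ler_pM => //.
  have -> : G_ = G - (G - G_) by ring.
  by apply: le_trans (ler_normB _ _) _; apply: lerD.
- rewrite -[X in _ --> X](mul0r Mf); apply: cvgM; last exact: cvg_cst.
  rewrite -[X in _ --> X]addr0; apply: cvgD.
    by rewrite -[X in _ --> X](mulr0 M); apply: cvgM => //; exact: cvg_cst.
  rewrite -[X in _ --> X](mul0r (M' + 0)); apply: cvgM => //.
  by apply: cvgD => //; exact: cvg_cst.
Qed.

(** [integral_carlitz] maps the kernel of indices (i, j) to the one of indices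
    (j, i), so the order is preserved. *)
Lemma integral_carlitz_span c :
  (forall n m, qherm_gram q n m = (n == m)%:R * (c * qfact q m)) ->
  forall a b k F, `|a| < 1 -> `|b| < 1 -> carlitz_span q a k F ->
  exists2 G, carlitz_span q (a * b) k G & forall v w, `|v| <= 2 -> `|w| <= 2 ->
    \int[leb]_(x in S) (F (scaled x) v * mehler b (scaled x) w * fN q x) = c * G v w.
Proof.
move=> orth a b k F a1 b1 [s [sk sE]].
exists (fun v w => \sum_(t <- s) (t.1 * b ^+ t.2.1) * carlitz (a * b) t.2.2 t.2.1 v w).
  exists [seq (t.1 * b ^+ t.2.1, (t.2.2, t.2.1)) | t <- s]; split.
    by rewrite all_map; apply: sub_all sk => t /=; rewrite addnC.
  by move=> u v _ _; rewrite big_map.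
move=> v w v2 w2.
transitivity (\int[leb]_(x in S) (\sum_(t <- s) t.1 *
   (carlitz a t.2.1 t.2.2 (scaled x) v * mehler b (scaled x) w * fN q x))).
  apply: Rint_ext => x /scaled_le2 x2; rewrite sE// !mulr_suml.
  by apply: eq_bigr => t _; ring.
rewrite (@Rint_sum _ _ _ leb _ mS fS); last first.
  move=> t; apply: bddmeasM; last exact: bddmeas_fN.
  by apply: bddmeasM; exact: bddmeas_carlitz_slice.
rewrite mulr_sumr; apply: eq_bigr => t _.
by rewrite (integral_carlitz orth)//; ring.
Qed.

Variables (r12 r13 r23 : R).
Hypotheses (h12 : `|r12| < 1) (h13 : `|r13| < 1) (h23 : `|r23| < 1).
Let r := r12 * r13 * r23.

Lemma norm_r12r13 : `|r12 * r13| < 1. Proof. by rewrite normrM mulr_ilt1. Qed.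
Lemma norm_r : `|r| < 1. Proof. by rewrite /r normrM mulr_ilt1// norm_r12r13. Qed.

Lemma bddmeas_carlitz_span_slice a k F w : `|a| < 1 -> `|w| <= 2 -> carlitz_span q a k F ->
  bddmeas S (fun y => F (scaled y) w).
Proof.
move=> a1 w2 [s [sk sE]].
apply: (@bddmeas_ext _ _ _ _ _ (fun x => \sum_(t <- s) t.1 * carlitz a t.2.1 t.2.2 (scaled x) w)).
  by move=> x /scaled_le2 x2; rewrite sE.
by apply: bddmeas_sum => t; apply: bddmeasZ; exact: bddmeas_carlitz_slice.
Qed.

Definition cond_integral1 n v w : R := \int[leb]_(x in S)
  (qherm q (scaled x) n * mehler r12 (scaled x) v * mehler r13 (scaled x) w * fN q x).

(** The integral over x and y of h_n(u) h_m(v) against the density of (X, Y, Z),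
    at w = sqrt(1-q) z and without the factors fN(z) and C3D.  The case
    n = m = 0 is the density of Z without the same factors. *)
Definition cond_integral n m w : R := \int[leb]_(y in S)
  (qherm q (scaled y) m * cond_integral1 n (scaled y) w * mehler r23 (scaled y) w * fN q y).

Lemma cond_integral1_carlitz_span c n :
  (forall n m, qherm_gram q n m = (n == m)%:R * (c * qfact q m)) ->
  exists2 F, carlitz_span q (r12 * r13) n F &
    forall v w, `|v| <= 2 -> `|w| <= 2 -> cond_integral1 n v w = c * F v w.
Proof.
move=> orth; have k0 : carlitz_span q r12 0 (carlitz r12 0 0) by exact: carlitz_span_carlitz.
have k1 := carlitz_span_qherm q1 n h12 k0; rewrite add0n in k1.
exact: (integral_carlitz_span orth h12 h13 k1).
Qed.

Lemma bddmeas_cond_integral n m w : `|w| <= 2 ->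
  bddmeas S (fun y => qherm q (scaled y) m * cond_integral1 n (scaled y) w * mehler r23 (scaled y) w * fN q y).
Proof.
move=> w2; have [c orth] := qherm_orthogonal q1; have [F kF FE] := cond_integral1_carlitz_span n orth.
apply: bddmeasM; last exact: bddmeas_fN.
apply: bddmeasM; last exact: bddmeas_carlitz_slice.
apply: bddmeasM; first exact: bddmeas_qherm.
apply: (@bddmeas_ext _ _ _ _ _ (fun y => c * F (scaled y) w)).
  by move=> y /scaled_le2 y2; rewrite FE.
by apply: bddmeasZ; apply: bddmeas_carlitz_span_slice kF => //; exact: norm_r12r13.
Qed.

(** The order grows by n when h_n(u) enters and by m when h_m(v) enters; the two
    integrations preserve it and successively multiply the parameters of the
    three kernels. *)
Lemma cond_integral_carlitz_span c n m :
  (forall n m, qherm_gram q n m = (n == m)%:R * (c * qfact q m)) ->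
  exists2 G, carlitz_span q r (n + m) G & forall w, `|w| <= 2 -> cond_integral n m w = c * (c * G w w).
Proof.
move=> orth; have [F kF FE] := cond_integral1_carlitz_span n orth.
have k2 := carlitz_span_qherm q1 m norm_r12r13 kF.
have [G kG GE] := integral_carlitz_span orth norm_r12r13 h23 k2.
exists G => // w w2; rewrite -GE// /cond_integral -RintegralZl; first last.
- apply: (@bddmeas_integrable _ _ _ leb _ mS fS); apply: bddmeasM; last exact: bddmeas_fN.
  apply: bddmeasM; last exact: bddmeas_carlitz_slice.
  apply: bddmeasM; first exact: bddmeas_qherm.
  by apply: bddmeas_carlitz_span_slice kF => //; exact: norm_r12r13.
- exact: mS.
by apply: Rint_ext => y /scaled_le2 y2; rewrite FE//; ring.
Qed.

Lemma cond_integral_00 c w : (forall n m, qherm_gram q n m = (n == m)%:R * (c * qfact q m)) ->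
  `|w| <= 2 -> cond_integral 0 0 w = c * (c * mehler r w w).
Proof.
move=> orth w2.
transitivity (\int[leb]_(y in S) (c * (carlitz (r12 * r13) 0 0 (scaled y) w * mehler r23 (scaled y) w * fN q y))).
  apply: Rint_ext => y /scaled_le2 y2; rewrite qherm0 mul1r 2!mulrA; congr (_ * _ * _).
  have := integral_carlitz orth 0 0 h12 h13 y2 w2; rewrite expr0 mulr1 => <-.
  by apply: eq_Rintegral => x _; rewrite qherm0 mul1r.
rewrite RintegralZl; first last.
- apply: (@bddmeas_integrable _ _ _ leb _ mS fS); apply: bddmeasM; last exact: bddmeas_fN.
  by apply: bddmeasM; apply: bddmeas_carlitz_slice => //; exact: norm_r12r13.
- exact: mS.
by rewrite (integral_carlitz orth 0 0 norm_r12r13 h23 w2 w2) expr0 mulr1.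
Qed.

Lemma cond_integral_poly n m : exists p : {poly R}, (size p <= (n + m).+1)%N /\
  forall w, `|w| <= 2 -> cond_integral n m w = p.[w] * cond_integral 0 0 w.
Proof.
have [c orth] := qherm_orthogonal q1.
have [G kG GE] := cond_integral_carlitz_span n m orth.
have [p [sp pE]] := diag_poly_carlitz_span q1 norm_r kG.
exists p; split=> // w w2; rewrite GE// pE// (cond_integral_00 orth)//; ring.
Qed.

(** The chain of [cond_integral_carlitz_span] carried out for n = m = 1, where
    all combinations are short enough to be written down. *)
Lemma cond_integral_11_carlitz c w : (forall n m, qherm_gram q n m = (n == m)%:R * (c * qfact q m)) ->
  `|w| <= 2 -> cond_integral 1 1 w = c * (c *
    (r13 * (r23 * carlitz r 1 1 w w + r12 * r13 * carlitz r 0 2 w w)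
     + r12 * (r23 ^+ 2 * carlitz r 0 2 w w + q * (r12 * r13) * (r23 * carlitz r 1 1 w w)
       + (1 - q) * mehler r w w))).
Proof.
move=> orth w2; pose g i j v := carlitz (r12 * r13) i j v w.
have bg i j : bddmeas S (fun y => c * (g i j (scaled y) * mehler r23 (scaled y) w * fN q y)).
  apply: bddmeasZ; apply: bddmeasM; last exact: bddmeas_fN.
  by apply: bddmeasM; apply: bddmeas_carlitz_slice => //; exact: norm_r12r13.
transitivity (\int[leb]_(y in S) (
   (r13 + q * r12 ^+ 2 * r13) * (c * (g 1 1 (scaled y) * mehler r23 (scaled y) w * fN q y))
   + (r12 * r13 ^+ 2 * (c * (g 0 2 (scaled y) * mehler r23 (scaled y) w * fN q y))
   + (r12 * (c * (g 2 0 (scaled y) * mehler r23 (scaled y) w * fN q y))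
   + (r12 * (1 - q) * (c * (g 0 0 (scaled y) * mehler r23 (scaled y) w * fN q y)) + 0))))).
  apply: Rint_ext => y /scaled_le2 y2; rewrite qherm1.
  have -> : cond_integral1 1 (scaled y) w = c * (r13 * g 0 1 (scaled y) + r12 * g 1 0 (scaled y)).
    transitivity (\int[leb]_(x in S) (
       1 * (carlitz r12 1 0 (scaled x) (scaled y) * mehler r13 (scaled x) w * fN q x)
       + r12 * (carlitz r12 0 1 (scaled x) (scaled y) * mehler r13 (scaled x) w * fN q x))).
      apply: Rint_ext => x /scaled_le2 x2; rewrite qherm1.
      have := carlitz_mulu q1 0 0 h12 x2 y2; rewrite expr0 subrr mul0r mul1r addr0 -/(mehler _ _ _) => ->.
      ring.
    have bx i j : bddmeas S (fun x => carlitz r12 i j (scaled x) (scaled y) * mehler r13 (scaled x) w * fN q x).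
      by apply: bddmeasM; [apply: bddmeasM; apply: bddmeas_carlitz_slice|exact: bddmeas_fN].
    rewrite (@Rint_lin _ _ _ leb _ mS fS)//; last exact: bddmeasZ.
    rewrite RintegralZl; [|exact: mS|exact: (@bddmeas_integrable _ _ _ leb _ mS fS)].
    by rewrite !(integral_carlitz orth)// /g expr0 expr1; ring.
  have e1 := carlitz_mulu q1 0 1 norm_r12r13 y2 w2.
  have e2 := carlitz_mulu q1 1 0 norm_r12r13 y2 w2.
  move: e1 e2; rewrite expr0 expr1 subrr /= => e1 e2.
  transitivity (c * (r13 * (scaled y * g 0 1 (scaled y)) + r12 * (scaled y * g 1 0 (scaled y)))
     * mehler r23 (scaled y) w * fN q y); first by ring.
  by rewrite e1 e2 /g; ring.
have b4 : bddmeas S (fun y => r12 * (1 - q) * (c * (g 0 0 (scaled y) * mehler r23 (scaled y) w * fN q y)) + 0).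
  by apply: bddmeasD; [exact: bddmeasZ|exact: bddmeas_cst].
have b3 := bddmeasD (bddmeasZ r12 (bg 2 0)) b4.
have b2 := bddmeasD (bddmeasZ (r12 * r13 ^+ 2) (bg 0 2)) b3.
rewrite !(@Rint_lin _ _ _ leb _ mS fS)//; last exact: bddmeas_cst.
have ig i j : \int[leb]_(y in S) (c * (g i j (scaled y) * mehler r23 (scaled y) w * fN q y)) =
    c * (c * r23 ^+ i * carlitz r j i w w).
  rewrite RintegralZl; first last.
  - apply: (@bddmeas_integrable _ _ _ leb _ mS fS); apply: bddmeasM; last exact: bddmeas_fN.
    by apply: bddmeasM; apply: bddmeas_carlitz_slice => //; exact: norm_r12r13.
  - exact: mS.
  by rewrite (integral_carlitz orth)//; exact: norm_r12r13.
rewrite !ig Rintegral_cst ?mul0r; last exact: mS.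
by rewrite expr0 expr1 (carlitz_sym _ _ 2 0) /mehler; ring.
Qed.

Lemma cond_integral_11 w : `|w| <= 2 -> cond_integral 1 1 w =
  (w ^+ 2 * ((r12 * (r13 ^+ 2 + r23 ^+ 2) * (1 - q * r)
         + (1 - r) * (r13 * r23 + q * r * r12))
        / ((1 + r) * (1 - q * r ^+ 2)))
   + (1 - q) * (r12 * (1 - r13 ^+ 2) * (1 - r23 ^+ 2) / (1 - q * r ^+ 2))) * cond_integral 0 0 w.
Proof.
move=> w2; have [c orth] := qherm_orthogonal q1.
rewrite (cond_integral_11_carlitz orth)// (cond_integral_00 orth)//.
have r1 := norm_r.
have d1 : 1 - r != 0 by apply: oneB_neq0.
have d2 : 1 + r != 0 by rewrite -[r]opprK; apply: oneB_neq0; rewrite normrN.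
have d3 : 1 - q * r ^+ 2 != 0.
  by apply: oneB_neq0; have := normX2_lt1 q1 1 r1; rewrite expr1.
have e01 : carlitz r 0 1 w w = w / (1 + r) * mehler r w w.
  have := carlitz_01 q1 r1 w2 w2.
  have -> : (w - r * w) * mehler r w w = (1 - r ^+ 2) * (w / (1 + r) * mehler r w w) by field.
  by apply: mulfI; rewrite (_ : 1 - r ^+ 2 = (1 - r) * (1 + r)); [rewrite mulf_neq0|ring].
have e11 : carlitz r 1 1 w w =
    (w ^+ 2 * (1 - r) + r * (1 - q) * (1 + r)) / ((1 + r) * (1 - q * r ^+ 2)) * mehler r w w.
  have := carlitz_11 q1 r1 w2 w2; set D := (1 - r ^+ 2) * _.
  have D0 : D != 0.
    by rewrite /D (_ : 1 - r ^+ 2 = (1 - r) * (1 + r)); [rewrite !mulf_neq0|ring].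
  move=> e; apply: (mulfI D0); rewrite e /D; field.
  by rewrite d2 d3.
have e02 : carlitz r 0 2 w w = w * carlitz r 0 1 w w - q * r * carlitz r 1 1 w w - (1 - q) * mehler r w w.
  by rewrite (carlitz_mulv q1 0 1 r1 w2 w2) expr1 /= /mehler; ring.
rewrite e02 e11 e01.
move: (mehler r w w) d2 d3 => P; rewrite /r => d2 d3.
by field; rewrite d2 d3.
Qed.
End KernelComposition.

(** * Densities and Fubini on boxes *)

Section Density.
Context d (T : measurableType d) (R : realType).

(** The function p agrees almost everywhere with the Radon-Nikodym derivative
    of nu. *)
Lemma integral_density (nu : {finite_measure set T -> \bar R})
    (mu : {sigma_finite_measure set T -> \bar R}) (p f : T -> \bar R) :
  mu.-integrable [set: T] p ->
  (forall A, measurable A -> nu A = \int[mu]_(x in A) p x)%E ->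
  nu.-integrable [set: T] f ->
  (\int[nu]_x f x = \int[mu]_x (f x * p x))%E.
Proof.
move=> ip nuE fi.
have mp := measurable_int _ ip.
have dom : nu `<< mu.
  apply/null_content_dominatesP => A mA muA; rewrite nuE//.
  by apply: null_set_integral => //; exact: measurable_funTS.
rewrite -(Radon_Nikodym_change_of_variables dom measurableT fi)//.
have iRN := Radon_Nikodym_integrable (nu := charge_of_finite_measure nu) dom.
apply: ae_eq_integral => //.
- apply: emeasurable_funM; first exact: measurable_int fi.
  exact: measurable_int iRN.
- by apply: emeasurable_funM => //; exact: measurable_int fi.
- apply: ae_eqe_mul2l.
  apply: integral_ae_eq => // E _ mE; rewrite -nuE//.
  by rewrite -Radon_Nikodym_integral.
Qed.

End Density.

Section ProductMeasure.
Context d1 d2 (T1 : measurableType d1) (T2 : measurableType d2) (R : realType).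
Variables (m1 : {sigma_finite_measure set T1 -> \bar R})
          (m2 : {sigma_finite_measure set T2 -> \bar R}).

(** An alias of the product measure, to which the sigma-finite structure needed
    to iterate the product is attached. *)
Definition prod_sfmeasure : set (T1 * T2)%type -> \bar R := (m1 \x m2)%E.

HB.instance Definition _ := Measure.on prod_sfmeasure.

Let prod_sfmeasure_sigma_finite : sigma_finite setT prod_sfmeasure.
Proof.
have [F [UF ndF finF]] := (sigma_finiteP _ _).1 (sigma_finiteT m1).
have [G [UG ndG finG]] := (sigma_finiteP _ _).1 (sigma_finiteT m2).
exists (fun n => F n `*` G n) => [|n].
  apply/esym/seteqP; split=> // -[x y] _.
  have [i _ Fx] : (\bigcup_n F n) x by rewrite -UF.
  have [j _ Gy] : (\bigcup_n G n) y by rewrite -UG.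
  exists (i + j)%N => //; split => /=.
    by apply: (subsetPset _ _ (ndF _ _ _) _ Fx); exact: leq_addr.
  by apply: (subsetPset _ _ (ndG _ _ _) _ Gy); exact: leq_addl.
have [mF fF] := finF n; have [mG fG] := finG n.
split; first exact: measurableX.
by rewrite /prod_sfmeasure product_measure1E// lte_mul_pinfty// ge0_fin_numE.
Qed.

HB.instance Definition _ := Measure_isSigmaFinite.Build _ _ _ prod_sfmeasure prod_sfmeasure_sigma_finite.

End ProductMeasure.

Section FubiniBox.
Context d1 d2 (T1 : measurableType d1) (T2 : measurableType d2) (R : realType).
Variables (m1 : {sigma_finite_measure set T1 -> \bar R})
          (m2 : {sigma_finite_measure set T2 -> \bar R}).
Variables (A : set T1) (B : set T2).
Hypotheses (mA : measurable A) (mB : measurable B).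
Hypotheses (fA : (m1 A < +oo)%E) (fB : (m2 B < +oo)%E).

Lemma finite_box : (prod_sfmeasure m1 m2 (A `*` B) < +oo)%E.
Proof. by rewrite /prod_sfmeasure product_measure1E// lte_mul_pinfty// ge0_fin_numE. Qed.

Lemma measurable_box : measurable (A `*` B).
Proof. exact: measurableX. Qed.

Lemma bddmeas_slice (F : T1 * T2 -> R) y : B y -> bddmeas (A `*` B) F ->
  bddmeas A (fun x => F (x, y)).
Proof.
move=> By bF; apply: (bddmeas_comp (f := fun x => (x, y)) measurable_box _ _ bF) => //.
by apply: measurable_funTS; exact: measurable_fun_pair.
Qed.

Lemma Rint_fubini (F : T1 * T2 -> R) : bddmeas (A `*` B) F ->
  \int[prod_sfmeasure m1 m2]_(u in A `*` B) F u =
  \int[m2]_(y in B) \int[m1]_(x in A) F (x, y).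
Proof.
move=> bF; have iF := bddmeas_integrable measurable_box finite_box bF.
rewrite /Rintegral; congr fine.
have iF' : (prod_sfmeasure m1 m2).-integrable setT ((EFin \o F) \_ (A `*` B)).
  exact/(integrable_mkcond _ measurable_box).
rewrite integral_mkcond -integral21_prod_meas1// [RHS]integral_mkcond.
apply: eq_integral => y _; rewrite /fubini_G /patch.
have [By|nBy] := pselect (B y); last first.
  rewrite ifF; last by apply/negP; rewrite inE.
  by apply: integral0_eq => x _; rewrite ifF//; apply/negP; rewrite inE => -[].
rewrite ifT; last by rewrite inE.
rewrite fineK; last first.
  by apply: integrable_fin_num => //; apply: (bddmeas_integrable mA fA); exact: bddmeas_slice.
rewrite [RHS]integral_mkcond; apply: eq_integral => x _; rewrite /patch.
by congr (if _ then _ else _); apply/idP/idP; rewrite !inE => //= -[].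
Qed.

End FubiniBox.

(** * The trivariate density *)

Section QHermitePolynomials.
Context {R : realType}.
Variable q : R.
Hypothesis q1 : `|q| < 1.

(** This converts the coefficient [n]_q of the recurrence of H_n into 1 - q^n. *)
Lemma qnumE n : (1 - q) * qnum q n = 1 - q ^+ n.
Proof. by rewrite /qnum -[RHS]opprB subrX1 -mulNr opprB. Qed.

Lemma qHermite_qherm n (x : R) : Num.sqrt (1 - q) ^+ n * (qHermite q n).[x] = qherm q (scaled q x) n.
Proof.
have s2 : Num.sqrt (1 - q) ^+ 2 = 1 - q by rewrite sqr_sqrtr// ltW// oneBq_gt0.
have [m] := ubnP n; elim: m n => // m IH [_|[_|n nm]].
- by rewrite expr0 mul1r qherm0 hornerC.
- rewrite qherm1 /= scaler0 subr0 mulr1 hornerX.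
  by rewrite expr1.
- rewrite qhermS [qHermite q n.+2]/= hornerD hornerN hornerM hornerX hornerZ.
  rewrite -(IH n.+1)// -(IH n.+1.-1)//=; last by lia.
  rewrite -qnumE /scaled; move: s2; set s := Num.sqrt _ => s2.
  by rewrite -s2 !(exprS s); ring.
Qed.
End QHermitePolynomials.

Section TrivariateDensity.
Context {R : realType}.
Variables q r12 r13 r23 : R.
Hypotheses (q1 : `|q| < 1) (h12 : `|r12| < 1) (h13 : `|r13| < 1) (h23 : `|r23| < 1).
Local Notation S := (Sq q : set (measurableTypeR R)).
Local Notation scaled := (scaled q).
Local Notation leb := (@lebesgue_measure R).
Local Notation leb2 := (prod_sfmeasure leb leb).
Local Notation mS := (measurable_Sq q).
Local Notation fS := (leb_Sq_fin q).
Local Notation mehler := (mehler q).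
Local Notation cond_integral := (cond_integral q r12 r13 r23).
Local Notation f3 := (f3D r12 r13 r23 q).
Local Notation R3 := (measurableTypeR R * measurableTypeR R * measurableTypeR R)%type.
Local Notation D := (Sq3 q : set R3).
Implicit Types x y z : R.

Lemma omegaqE x y rho : omegaq q x y rho = omega (scaled x) (scaled y) rho.
Proof.
rewrite /omega !scaled_sqr// /omegaq.
have -> : scaled x * scaled y = (1 - q) * x * y.
  rewrite /scaled mulrACA -expr2 sqr_sqrtr ?mulrA// ltW// oneBq_gt0//.
ring.
Qed.

(** The infinite product of f3D is the product of three infinite products,
    each evaluated by [mehler_product]; the Pochhammer symbols cancel. *)
Lemma f3D_unnorm_mehler x y z : Sq q x -> Sq q y -> Sq q z ->
  f3D_unnorm r12 r13 r23 q x y z = fN q x * fN q y * fN q z *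
    (mehler r12 (scaled x) (scaled y) * mehler r13 (scaled x) (scaled z) * mehler r23 (scaled y) (scaled z)).
Proof.
move=> /(scaled_le2 q1) x2 /(scaled_le2 q1) y2 /(scaled_le2 q1) z2.
have [p12 c12] := mehler_product q1 h12 x2 y2.
have [p13 c13] := mehler_product q1 h13 x2 z2.
have [p23 c23] := mehler_product q1 h23 y2 z2.
rewrite /f3D_unnorm; congr *%R.
have -> : infprod (fun i => omegaq q x y (r12 * q ^+ i) * omegaq q x z (r13 * q ^+ i)
    * omegaq q y z (r23 * q ^+ i)) =
   qpoch q (r12 ^+ 2) / mehler r12 (scaled x) (scaled y) * (qpoch q (r13 ^+ 2) / mehler r13 (scaled x) (scaled z))
    * (qpoch q (r23 ^+ 2) / mehler r23 (scaled y) (scaled z)).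
  apply: cvg_lim => //.
  rewrite (_ : (fun n => _) = (fun N => \prod_(k < N) omega (scaled x) (scaled y) (r12 * q ^+ k)
     * \prod_(k < N) omega (scaled x) (scaled z) (r13 * q ^+ k)
     * \prod_(k < N) omega (scaled y) (scaled z) (r23 * q ^+ k))); last first.
    apply/funext => N; rewrite -!big_split/=; apply: eq_bigr => k _.
    by rewrite !omegaqE.
  by apply: cvgM => //; exact: cvgM.
have n2 (a : R) : `|a| < 1 -> qpoch q (a ^+ 2) != 0.
  by move=> a1; rewrite gt_eqF// qpoch_gt0// normrX exprn_ilt1.
field.
by rewrite p12 p13 p23 !n2.
Qed.

Lemma f3D_mehler x y z : Sq q x -> Sq q y -> Sq q z ->
  f3 x y z = C3D r12 r13 r23 q * (fN q x * fN q y * fN q z *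
    (mehler r12 (scaled x) (scaled y) * mehler r13 (scaled x) (scaled z) * mehler r23 (scaled y) (scaled z))).
Proof. by move=> Sx Sy Sz; rewrite /f3D f3D_unnorm_mehler. Qed.

Lemma measurable_Sq3 : measurable D.
Proof. by apply: measurableX; [apply: measurableX|]; exact: mS. Qed.

Let mS2 : measurable (S `*` S). Proof. exact: measurableX mS mS. Qed.

Lemma leb_Sq2_fin : (leb2 (S `*` S) < +oo)%E.
Proof. exact: (@finite_box _ _ _ _ R leb leb S S mS mS fS fS). Qed.

Lemma leb3_Sq3_fin : (prod_sfmeasure leb2 leb D < +oo)%E.
Proof. exact: (@finite_box _ _ _ _ R leb2 leb (S `*` S) S mS2 mS leb_Sq2_fin fS). Qed.

Section Coordinates.
Variables (F : R -> R).
Hypothesis bF : bddmeas S F.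

Lemma bddmeas_coord1 : bddmeas D (fun u => F u.1.1).
Proof.
apply: (bddmeas_comp (f := fun u : R3 => u.1.1) mS _ _ bF); last by move=> u [[]].
by apply: measurable_funTS; apply: measurableT_comp; exact: measurable_fst.
Qed.

Lemma bddmeas_coord2 : bddmeas D (fun u => F u.1.2).
Proof.
apply: (bddmeas_comp (f := fun u : R3 => u.1.2) mS _ _ bF); last by move=> u [[]].
by apply: measurable_funTS; apply: (measurableT_comp measurable_snd); exact: measurable_fst.
Qed.

Lemma bddmeas_coord3 : bddmeas D (fun u => F u.2).
Proof.
apply: (bddmeas_comp (f := fun u : R3 => u.2) mS _ _ bF); last by move=> u [].
by apply: measurable_funTS; exact: measurable_snd.
Qed.
End Coordinates.

Lemma bddmeas_f3D : bddmeas D (fun u => f3 u.1.1 u.1.2 u.2).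
Proof.
apply: (@bddmeas_ext _ _ _ _ _ (fun u : R3 => C3D r12 r13 r23 q *
   (fN q u.1.1 * fN q u.1.2 * fN q u.2 *
    (mehler r12 (scaled u.1.1) (scaled u.1.2) * mehler r13 (scaled u.1.1) (scaled u.2) * mehler r23 (scaled u.1.2) (scaled u.2))))).
  by move=> u [[? ?] ?]; rewrite f3D_mehler.
have b1 := bddmeas_coord1 (bddmeas_scaled q); have b2 := bddmeas_coord2 (bddmeas_scaled q).
have b3 := bddmeas_coord3 (bddmeas_scaled q).
have l1 (u : R3) : D u -> `|scaled u.1.1| <= 2 by move=> [[? ?] ?]; exact: scaled_le2.
have l2 (u : R3) : D u -> `|scaled u.1.2| <= 2 by move=> [[? ?] ?]; exact: scaled_le2.
have l3 (u : R3) : D u -> `|scaled u.2| <= 2 by move=> [[? ?] ?]; exact: scaled_le2.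
apply: bddmeasZ; apply: bddmeasM.
  apply: bddmeasM; last by apply: bddmeas_coord3; exact: bddmeas_fN.
  apply: bddmeasM; [apply: bddmeas_coord1|apply: bddmeas_coord2]; exact: bddmeas_fN.
apply: bddmeasM; last exact: bddmeas_carlitz.
by apply: bddmeasM; exact: bddmeas_carlitz.
Qed.

(** Fubini, with the factors that depend on z alone taken out of the inner
    integrals. *)
Lemma integral_f3D n m (k : R -> R) : bddmeas S k ->
  \int[(prod_sfmeasure leb2 leb)]_(u in D)
     (k u.2 * (qherm q (scaled u.1.1) n * qherm q (scaled u.1.2) m) * f3 u.1.1 u.1.2 u.2) =
  \int[leb]_(z in S) (C3D r12 r13 r23 q * k z * fN q z * cond_integral n m (scaled z)).
Proof.
move=> bk.
have bh n' := bddmeas_qherm q q n'.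
have bF : bddmeas D (fun u => k u.2 * (qherm q (scaled u.1.1) n * qherm q (scaled u.1.2) m) * f3 u.1.1 u.1.2 u.2).
  apply: bddmeasM; last exact: bddmeas_f3D.
  apply: bddmeasM; first exact: bddmeas_coord3.
  by apply: bddmeasM; [exact: (bddmeas_coord1 (bh n))|exact: (bddmeas_coord2 (bh m))].
rewrite (@Rint_fubini _ _ _ _ R leb2 leb (S `*` S) S mS2 mS leb_Sq2_fin fS _ bF).
apply: Rint_ext => z Sz /=.
have bG := bddmeas_slice mS2 mS Sz bF.
rewrite (@Rint_fubini _ _ _ _ R leb leb S S mS mS fS fS _ bG)/=.
have z2 := scaled_le2 q1 Sz.
rewrite /cond_integral -RintegralZl; first last.
- by apply: (@bddmeas_integrable _ _ _ leb _ mS fS); exact: bddmeas_cond_integral.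
- exact: mS.
apply: Rint_ext => y Sy; have y2 := scaled_le2 q1 Sy.
rewrite /cond_integral1.
have bx : bddmeas S (fun x => qherm q (scaled x) n * mehler r12 (scaled x) (scaled y) * mehler r13 (scaled x) (scaled z) * fN q x).
  apply: bddmeasM; last exact: bddmeas_fN.
  apply: bddmeasM; last exact: bddmeas_carlitz_slice.
  by apply: bddmeasM => //; exact: bddmeas_carlitz_slice.
set I := \int[leb]_(x in S) (qherm q (scaled x) n * _ * _ * _).
transitivity ((C3D r12 r13 r23 q * k z * fN q z * qherm q (scaled y) m * mehler r23 (scaled y) (scaled z) * fN q y) * I);
  last by ring.
rewrite /I -RintegralZl; first last.
- exact: (@bddmeas_integrable _ _ _ leb _ mS fS).
- exact: mS.
by apply: Rint_ext => x Sx; rewrite f3D_mehler//; ring.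
Qed.

End TrivariateDensity.

(** * The joint law of (X, Y, Z) *)

Section JointLaw.
Context {R : realType} (d : measure_display) (T : measurableType d) (P : probability T R).
Variables (X Y Z : {RV P >-> R}) (q r12 r13 r23 : R).
Hypotheses (q1 : `|q| < 1) (h12 : `|r12| < 1) (h13 : `|r13| < 1) (h23 : `|r23| < 1).
Hypothesis hXYZ : has_joint_density X Y Z (Sq3 q) (f3D r12 r13 r23 q).
Local Notation leb := (@lebesgue_measure R).
Local Notation leb2 := (prod_sfmeasure leb leb).
Local Notation leb3 := (prod_sfmeasure leb2 leb).
Local Notation R3 := (measurableTypeR R * measurableTypeR R * measurableTypeR R)%type.
Local Notation D := (Sq3 q : set R3).
Local Notation f3 := (f3D r12 r13 r23 q).

Definition triple (w : T) : R3 := (X w, Y w, Z w).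

Lemma measurable_triple : measurable_fun [set: T] triple.
Proof.
apply: measurable_fun_pair; last exact: (@measurable_funPT _ _ _ _ Z).
apply: measurable_fun_pair; first exact: (@measurable_funPT _ _ _ _ X).
exact: (@measurable_funPT _ _ _ _ Y).
Qed.

HB.instance Definition _ := isMeasurableFun.Build _ _ _ _ triple measurable_triple.

Let law : probability R3 R := distribution P triple.

Let mD : measurable D := measurable_Sq3 q.

Let lawE A : measurable A ->
  law A = (\int[leb3]_(u in A) (((fun u : R3 => f3 u.1.1 u.1.2 u.2) \_ D) u)%:E)%E.
Proof.
move=> mA; rewrite /law /distribution /pushforward.
transitivity (\int[leb3]_(u in A `&` D) (f3 u.1.1 u.1.2 u.2)%:E)%E; first exact: hXYZ.
by rewrite integral_mkcondr restrict_EFin.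
Qed.

(** The density is only integrated over S(q)^3, so (X, Y, Z) lies there almost
    surely; hence u only has to be bounded on S(q)^3 in what follows. *)
Lemma outside_null : P (~` (triple @^-1` D)) = 0%E.
Proof.
transitivity (law (~` D)); first by [].
rewrite lawE; last exact: measurableC.
apply: integral0_eq => u nDu; rewrite /patch ifF//.
by apply/negP; rewrite inE.
Qed.

Let mtD : measurable (triple @^-1` D).
Proof. by rewrite -[X in measurable X]setTI; exact: measurable_triple. Qed.

Variable u : R3 -> R.
Hypotheses (mu : measurable_fun [set: R3] u) (bu : bddmeas D u).

Lemma integrable_triple : P.-integrable [set: T] (EFin \o (u \o triple)).
Proof.
have mut : measurable_fun [set: T] (u \o triple) by exact: measurableT_comp measurable_triple.
apply/(negligible_integrable (measurableC mtD) measurableT _ outside_null).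
  exact/measurable_EFinP.
have -> : [set: T] `\` ~` (triple @^-1` D) = triple @^-1` D.
  by rewrite setDE setCK setTI.
apply: bddmeas_integrable => //; first by rewrite (le_lt_trans (probability_le1 _ _))// ltry.
split; first exact: measurable_funTS.
by have [_ [M uM]] := bu; exists M => w; exact: uM.
Qed.

(** The integrand is replaced by its restriction to S(q)^3, which is bounded,
    before the transfer to the law of (X, Y, Z). *)
Lemma integral_triple (B : set R) : measurable B ->
  (\int[P]_(w in Z @^-1` B) (u (triple w))%:E =
   \int[leb3]_(v in D) (\1_B v.2 * u v * f3 v.1.1 v.1.2 v.2)%:E)%E.
Proof.
move=> mB; have mZB : measurable (Z @^-1` B).
  by rewrite -[X in measurable X]setTI; exact: (measurable_funPT Z).
(* A bounded function on the whole space, to which the law applies. *)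
pose h : R3 -> R := (fun v => \1_B v.2 * u v) \_ D.
have bI : bddmeas D (fun v : R3 => \1_B v.2 : R).
  split; last by exists 1 => v _; rewrite indicE; case: (_ \in _); rewrite ?normr1 ?normr0.
  by apply: measurable_funTS; apply: measurableT_comp; [exact: measurable_indic|exact: measurable_snd].
have bIu := bddmeasM bI bu.
have mh : measurable_fun [set: R3] h by apply/(measurable_restrictT _ mD); exact: bIu.1.
have hM : exists M, forall v, `|h v| <= M.
  have [_ [M hM]] := bIu; exists (Num.max M 0) => v; rewrite /h /patch.
  case: ifPn => [/[1!inE] /hM vM|_]; first by rewrite le_max vM.
  by rewrite normr0 le_max lexx orbT.
have ih : law.-integrable [set: R3] (EFin \o h).
  have fin : (law setT < +oo)%E by rewrite probability_setT ltry.
  apply: (bddmeas_integrable measurableT fin).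
  by split=> //; have [M HM] := hM; exists M.
have ihP : P.-integrable [set: T] (EFin \o (h \o triple)).
  have fin : (P setT < +oo)%E by rewrite probability_setT ltry.
  apply: (bddmeas_integrable measurableT fin).
  split; first exact: measurableT_comp measurable_triple.
  by have [M HM] := hM; exists M => w _; exact: HM.
transitivity (\int[P]_w (h (triple w))%:E)%E.
  rewrite (negligible_integral (measurableC mtD) mZB _ outside_null); last first.
    exact: (integrableS measurableT mZB _ integrable_triple).
  rewrite integral_mkcond; apply: eq_integral => w _.
  rewrite /h /patch setDE setCK.
  have [Dw|nDw] := pselect (D (triple w)); last first.
    rewrite ifF; last by apply/negP; rewrite inE => -[].
    by rewrite ifF//; apply/negP; rewrite inE.
  rewrite [in RHS]ifT ?inE// indicE.
  have [Bw|nBw] := pselect (B (Z w)).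
    by rewrite ifT ?inE// mem_set// mul1r.
  rewrite ifF; last by apply/negP; rewrite inE => -[].
  by rewrite memNset// mul0r.
have := integral_pushforward measurable_triple (mu := P) (D := [set: R3])
  (f := EFin \o h).
rewrite preimage_setT => <-//; last exact/measurable_EFinP.
have bf := bddmeas_f3D q1 h12 h13 h23.
have if3 : leb3.-integrable [set: R3]
    (EFin \o ((fun u : R3 => f3 u.1.1 u.1.2 u.2) \_ D)).
  rewrite -restrict_EFin; apply/(integrable_mkcond _ mD).
  by apply: (bddmeas_integrable mD _ bf); exact: leb3_Sq3_fin.
rewrite [LHS](integral_density if3 lawE ih) [RHS]integral_mkcond.
apply: eq_integral => v _; rewrite /h /= /patch.
by case: ifPn => _; rewrite -EFinM ?mul0r.
Qed.

End JointLaw.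

(** * Conditional expectations given Z *)

Section ConditionalExpectation.
Context {R : realType} (d : measure_display) (T : measurableType d) (P : probability T R).
Variables (X Y Z : {RV P >-> R}) (q r12 r13 r23 : R).
Hypotheses (q1 : `|q| < 1) (h12 : `|r12| < 1) (h13 : `|r13| < 1) (h23 : `|r23| < 1).
Hypothesis hXYZ : has_joint_density X Y Z (Sq3 q) (f3D r12 r13 r23 q).
Local Notation leb := (@lebesgue_measure R).
Local Notation leb3 := (prod_sfmeasure (prod_sfmeasure leb leb) leb).
Local Notation R3 := (measurableTypeR R * measurableTypeR R * measurableTypeR R)%type.
Local Notation D := (Sq3 q : set R3).
Local Notation S := (Sq q : set (measurableTypeR R)).
Local Notation f3 := (f3D r12 r13 r23 q).
Local Notation cond_integral := (cond_integral q r12 r13 r23).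

(** Both integrals over an event Z in B become integrals over z in S(q) of the
    same function, by the hypothesis on g.  The power of sqrt(1-q) comes from
    the rescaling of H_n and H_m. *)
Lemma condexp_of_cond_integral n m (g : R -> R) : continuous g ->
  (forall z, Sq q z ->
    cond_integral n m (scaled q z) = Num.sqrt (1 - q) ^+ (n + m) * g z * cond_integral 0 0 (scaled q z)) ->
  is_condexp (fun w => (qHermite q n).[X w] * (qHermite q m).[Y w]) Z (g \o Z).
Proof.
move=> cg gE; set s := Num.sqrt (1 - q); have s0 : s != 0 by rewrite gt_eqF// sqrtq_gt0.
pose U (v : R3) : R := (qHermite q n).[v.1.1] * (qHermite q m).[v.1.2].
pose V (v : R3) : R := g v.2.
have mg : measurable_fun [set: measurableTypeR R] g by exact: continuous_measurable_fun.
have mp (p : {poly R}) : measurable_fun [set: measurableTypeR R] (fun x => p.[x]).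
  by apply: continuous_measurable_fun; exact: continuous_horner.
have mU : measurable_fun [set: R3] U.
  apply: measurable_funM.
    by apply: (measurableT_comp (mp _)); apply: measurableT_comp; exact: measurable_fst.
  by apply: (measurableT_comp (mp _)); apply: (measurableT_comp measurable_snd); exact: measurable_fst.
have mV : measurable_fun [set: R3] V by apply: (measurableT_comp mg); exact: measurable_snd.
have bp (p : {poly R}) : bddmeas S (fun x => p.[x]) by exact/bddmeas_continuous/continuous_horner.
have bg : bddmeas S g by exact: bddmeas_continuous.
have bU : bddmeas D U by apply: bddmeasM; [exact: (bddmeas_coord1 (bp _))|exact: (bddmeas_coord2 (bp _))].
have bV : bddmeas D V by exact: (bddmeas_coord3 bg).
split.
- exact: (integrable_triple hXYZ mU bU).
- exact: (integrable_triple hXYZ mV bV).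
- move=> B mB; exists (g @^-1` B); last by rewrite setTI.
  by rewrite -[X in measurable X]setTI; exact: mg.
- move=> _ [B mB <-]; rewrite setTI.
  rewrite [LHS](integral_triple q1 h12 h13 h23 hXYZ mV bV mB).
  rewrite [RHS](integral_triple q1 h12 h13 h23 hXYZ mU bU mB).
  have bI : bddmeas S (\1_B : R -> R).
    split; first by apply: measurable_funTS; exact: measurable_indic.
    by exists 1 => z _; rewrite indicE; case: (_ \in _); rewrite ?normr1 ?normr0.
  have bf := bddmeas_f3D q1 h12 h13 h23.
  have bID := bddmeas_coord3 bI.
  have fin3 := leb3_Sq3_fin q; have mD := measurable_Sq3 q.
  rewrite (EFin_Rint mD fin3); last by apply: bddmeasM bf; exact: bddmeasM.
  rewrite (EFin_Rint mD fin3); last by apply: bddmeasM bf; exact: bddmeasM.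
  congr EFin.
  transitivity (\int[leb3]_(u in D) ((\1_B u.2 * g u.2) *
      (qherm q (scaled q u.1.1) 0 * qherm q (scaled q u.1.2) 0) * f3 u.1.1 u.1.2 u.2)).
    by apply: Rint_ext => u _; rewrite !qherm0 !mulr1.
  rewrite (integral_f3D q1 h12 h13 h23 0 0 (bddmeasM bI bg)).
  transitivity (\int[leb3]_(u in D) ((\1_B u.2 * s ^- (n + m)) *
      (qherm q (scaled q u.1.1) n * qherm q (scaled q u.1.2) m) * f3 u.1.1 u.1.2 u.2)); last first.
    apply: Rint_ext => u _; rewrite /U -!(qHermite_qherm q1) -/s exprD; field.
    by rewrite !expf_neq0.
  rewrite (integral_f3D q1 h12 h13 h23 n m (bddmeasM bI (bddmeas_cst _ (s ^- (n + m))))).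
  apply: Rint_ext => z Sz; rewrite (gE z Sz) -/s; field.
  by rewrite expf_neq0.
Qed.

End ConditionalExpectation.

Theorem corollary1 (R : realType) (q rho12 rho13 rho23 : R)
    (d : measure_display) (T : measurableType d) (P : probability T R)
    (X Y Z : {RV P >-> R})
    (hq : -1 < q < 1) (h12 : -1 < rho12 < 1)
    (h13 : -1 < rho13 < 1) (h23 : -1 < rho23 < 1)
    (hXYZ : has_joint_density X Y Z (Sq3 q) (f3D rho12 rho13 rho23 q)) :
  let r := rho12 * rho13 * rho23 in
  (forall n m : nat, exists p : {poly R},
     (size p <= (n + m).+1)%N /\
     is_condexp (fun w => (qHermite q n).[X w] * (qHermite q m).[Y w]) Z
       (fun w => p.[Z w])) /\
  is_regression (fun w => X w * Y w) Z
    (fun z => z ^+ 2 *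
       ((rho12 * (rho13 ^+ 2 + rho23 ^+ 2) * (1 - q * r)
         + (1 - r) * (rho13 * rho23 + q * r * rho12))
        / ((1 + r) * (1 - q * r ^+ 2)))
       + rho12 * (1 - rho13 ^+ 2) * (1 - rho23 ^+ 2) / (1 - q * r ^+ 2)).
Proof.
move=> r.
have q1 : `|q| < 1 by rewrite ltr_norml.
have a12 : `|rho12| < 1 by rewrite ltr_norml.
have a13 : `|rho13| < 1 by rewrite ltr_norml.
have a23 : `|rho23| < 1 by rewrite ltr_norml.
have s0 : Num.sqrt (1 - q) != 0 by rewrite gt_eqF// sqrtq_gt0.
split=> [n m|].
  have [p [sp pE]] := cond_integral_poly q1 a12 a13 a23 n m.
  pose p' := Num.sqrt (1 - q) ^- (n + m) *: (p \Po (Num.sqrt (1 - q) *: 'X)).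
  exists p'; split.
    apply: leq_trans (size_scale_leq _ _) _; apply: leq_trans (size_comp_poly_leq _ _) _.
    by rewrite size_scale// size_polyX muln1 ltnS; case: (size p) sp.
  apply: (condexp_of_cond_integral q1 a12 a13 a23 hXYZ (@continuous_horner _ p')).
  move=> z Sz; rewrite pE; last exact: scaled_le2.
  by rewrite hornerZ horner_comp hornerZ hornerX mulVKf ?expf_neq0.
rewrite /is_regression; set g := (G in measurable_fun _ G /\ _).
have cg : continuous g.
  move=> z; apply: cvgD; last exact: cvg_cst.
  by apply: cvgM; [exact: exprn_continuous|exact: cvg_cst].
split; first exact: continuous_measurable_fun.
rewrite (_ : (fun w => X w * Y w) = fun w => (qHermite q 1).[X w] * (qHermite q 1).[Y w]).
  apply: (condexp_of_cond_integral q1 a12 a13 a23 hXYZ cg) => z Sz.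
  rewrite (cond_integral_11 q1 a12 a13 a23); last exact: scaled_le2.
  by rewrite scaled_sqr// sqr_sqrtr ?(ltW (oneBq_gt0 q1))// /g -/r; ring.
by apply/funext => w; rewrite /= scaler0 subr0 mulr1 !hornerX.
Qed.
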